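(* Let $T$ be the extension of the theory of Boolean algebras in a language with a further finite set of operations, and with further axioms asserting that each operation satisfies some condition chosen among (A1e)–(C3) in the list given in the context. Then the set of universal consequences of $T$ is decidable. The same applies to distributive lattices in place of Boolean algebras; more generally, to any locally finite universal theory $T_0$ of lattices, provided the function $g_{T_0}$ described in the context is effectively computable; and, excluding case (C3), to partially ordered sets, join semilattices, meet semilattices.
   Context: A universal theory $T_0$ is locally finite if every finitely generated model of $T_0$ is finite. If $T_0$ is universal, in a finite language, and locally finite, then there is a function $g_{T_0}:\mathbb N\to\mathbb N$ such that, for every $m\in\mathbb N$, every model of $T_0$ generated by $m$ elements has cardinality $\le g_{T_0}(m)$. A universal sentence is one of the form $\forall\bar x\,\psi$ with $\psi$ quantifier-free. Properties of an operation on an ordered structure. For a unary operation $K$: (A1e) extensive ($x\le Kx$ for all $x$); (A1c) contractive ($Kx\le x$ for all $x$); (A2) idempotent ($KKx=Kx$ for all $x$); (A2e) idempotent and extensive; (A2c) idempotent and contractive; (A3) involutive ($KKx=x$ for all $x$); (B1) isotone ($x\le y$ implies $Kx\le Ky$); (B1e) isotone and extensive; (B1c) isotone and contractive; (B2) isotone and idempotent; (B3) a closure operation (isotone, extensive and idempotent); (B4) an interior operation (isotone, contractive and idempotent); (B5) antitone ($x\le y$ implies $Ky\le Kx$). For an $n$-ary operation $F$ ($n\ge 1$, $i,j\ge 0$, $i+j\le n$): (C1)$_{i,j,n}$ $F$ is isotone on the first $i$ components and antitone on the last $j$ components (each component being varied with the other arguments fixed); (C2)$_{i,j,n,h}$ $F$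 satisfies (C1)$_{i,j,n}$ and moreover $x_1\le F\bar x,\dots,x_h\le F\bar x$ for all $\bar x$, where $h\le i$ is fixed; (C3)$_{i,j,n,t}$ (for lattice-ordered structures) $F$ satisfies (C1)$_{i,j,n}$ and moreover $t(x_1,\dots,x_i)\le F\bar x$ for all $\bar x$, where $t$ is a given lattice term. No additivity or multiplicativity is assumed for closure and interior operations.
   Formalization: For a general locally finite universal theory T_0 of lattices, it is additionally assumed decidable whether a given finite structure is a model of T_0 (automatic if T_0 is finitely axiomatized); without this the claim fails for some non-recursive T_0. *)

(* Defs.v *)
From HB Require Import structures.
From mathcomp Require Import all_boot.

Set Implicit Arguments.
Unset Strict Implicit.
Unset Printing Implicit Defensive.

(** * Computability

    The partial recursive functions, in Kleene's presentation (basic functions,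
    composition, primitive recursion, minimization), over finite binary trees
    instead of natural numbers: this is the same notion of computability, and
    syntax is coded by trees without any Goedel numbering.  Natural numbers are
    coded in unary by [num]. *)

Inductive tree : Type := Leaf | Node of tree & tree.

Fixpoint num (n : nat) : tree :=
  if n is k.+1 then Node Leaf (num k) else Leaf.

Definition tlist (s : seq tree) : tree := foldr Node Leaf s.

Inductive prog : Type :=
  | PLeaf
  | PId
  | PLeft
  | PRight
  | PNode of prog & prog
  | PComp of prog & prog
  | PRec of prog & prog
  | PMu of prog.

(** [run p x y]: the program [p] halts on the input [x] with output [y].
    [PRec p q] sends [Node e t] to [R t], where [R Leaf = p e] and
    [R (Node a b) = q (Node (Node e (Node a b)) (Node (R a) (R b)))].
    [PMu p] sends [x] to the least [n] such that [p (Node x n)] is [Leaf]. *)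
Fixpoint run (p : prog) : tree -> tree -> Prop :=
  match p with
  | PLeaf => fun _ y => y = Leaf
  | PId => fun x y => y = x
  | PLeft => fun x y => y = if x is Node a _ then a else Leaf
  | PRight => fun x y => y = if x is Node _ b then b else Leaf
  | PNode p q => fun x y => exists a b, [/\ run p x a, run q x b & y = Node a b]
  | PComp p q => fun x y => exists2 z, run q x z & run p z y
  | PRec p q => fun x y =>
      if x is Node e t then
        (fix R (t : tree) (y : tree) : Prop :=
           match t with
           | Leaf => run p e y
           | Node a b => exists u v, [/\ R a u, R b v &
               run q (Node (Node e (Node a b)) (Node u v)) y]
           end) t y
      else False
  | PMu p => fun x y => exists n, [/\ y = num n,
        run p (Node x (num n)) Leaf
      & forall k, k < n -> exists a b, run p (Node x (num k)) (Node a b)]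
  end.

Definition computable (g : nat -> nat) : Prop :=
  exists p, forall n, run p (num n) (num (g n)).

Definition decides (p : prog) (x : tree) (P : Prop) : Prop :=
  (P -> run p x (num 1)) /\ (~ P -> run p x (num 0)).

(** * Universal sentences in a finite first-order language *)

Record signature : Type := Signature {
  fun_sym : finType; farity : fun_sym -> nat;
  rel_sym : finType; rarity : rel_sym -> nat }.

Inductive term (L : signature) (n : nat) : Type :=
  | Var of 'I_n
  | App (f : fun_sym L) of ('I_(farity f) -> term L n).

Inductive qfree (L : signature) (n : nat) : Type :=
  | QEq of term L n & term L n
  | QRel (r : rel_sym L) of ('I_(rarity r) -> term L n)
  | QFalse
  | QNot of qfree L n
  | QAnd of qfree L n & qfree L n
  | QOr of qfree L n & qfree L n
  | QImp of qfree L n & qfree L n.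

(** [Forall psi] is [forall x_0 ... x_(n-1), psi]. *)
Inductive usentence (L : signature) : Type :=
  | Forall (n : nat) of qfree L n.

(** Classically, boolean-valued relations are no restriction. *)
Record structure (L : signature) (A : Type) : Type := Structure {
  fint : forall f : fun_sym L, ('I_(farity f) -> A) -> A;
  rint : forall r : rel_sym L, ('I_(rarity r) -> A) -> bool }.

Arguments fint {L A} _ f _.
Arguments rint {L A} _ r _.

Section Semantics.
Variables (L : signature) (A : Type) (M : structure L A).

Fixpoint teval n (v : 'I_n -> A) (t : term L n) : A :=
  match t with
  | Var i => v i
  | App f a => fint M f (fun i : 'I_(farity f) => teval v (a i))
  end.

Fixpoint qholds n (v : 'I_n -> A) (q : qfree L n) : Prop :=
  match q with
  | QEq s t => teval v s = teval v t
  | QRel r a => rint M r (fun i : 'I_(rarity r) => teval v (a i))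
  | QFalse => False
  | QNot p => ~ qholds v p
  | QAnd p q => qholds v p /\ qholds v q
  | QOr p q => qholds v p \/ qholds v q
  | QImp p q => qholds v p -> qholds v q
  end.

Definition holds (s : usentence L) : Prop :=
  let: Forall n q := s in forall v : 'I_n -> A, qholds v q.

Definition generated_by m (a : 'I_m -> A) : Prop :=
  forall x, exists t : term L m, teval a t = x.

End Semantics.

Definition card_le (A : Type) (k : nat) : Prop :=
  exists f : A -> 'I_k, injective f.

Definition finite_type (A : Type) : Prop := exists k, card_le A k.

(** A theory, given through its class of models.  As usual the models are the
    nonempty members: every quantification over models below comes with
    [inhabited A]. *)
Definition class (L : signature) : Type :=
  forall A : Type, structure L A -> Prop.

Definition consequence (L : signature) (T : class L) (s : usentence L) : Prop :=
  forall (A : Type) (M : structure L A), inhabited A -> T A M -> holds M s.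

(** ** Universal theories, as sets of universal sentences *)

Definition utheory (L : signature) : Type := usentence L -> Prop.

Definition models (L : signature) (T0 : utheory L) : class L :=
  fun A M => forall s, T0 s -> holds M s.

Definition locally_finite (L : signature) (T0 : utheory L) : Prop :=
  forall (A : Type) (M : structure L A), inhabited A -> models T0 M ->
  (exists m (a : 'I_m -> A), generated_by M a) -> finite_type A.

Definition generation_bound (L : signature) (T0 : utheory L) (g : nat -> nat) :
    Prop :=
  forall (A : Type) (M : structure L A), inhabited A -> models T0 M ->
  forall m (a : 'I_m -> A), generated_by M a -> card_le A (g m).

(** * Codes of sentences and of finite structures *)

Section Codes.
Variable L : signature.

Fixpoint tcode n (t : term L n) : tree :=
  match t with
  | Var i => Node (num 0) (num i)
  | App f a => Node (num 1) (Node (num (enum_rank f))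
                 (tlist [seq tcode (a i) | i <- enum 'I_(farity f)]))
  end.

Fixpoint qcode n (q : qfree L n) : tree :=
  match q with
  | QEq s t => Node (num 0) (Node (tcode s) (tcode t))
  | QRel r a => Node (num 1) (Node (num (enum_rank r))
                  (tlist [seq tcode (a i) | i <- enum 'I_(rarity r)]))
  | QFalse => Node (num 2) Leaf
  | QNot p => Node (num 3) (qcode p)
  | QAnd p q => Node (num 4) (Node (qcode p) (qcode q))
  | QOr p q => Node (num 5) (Node (qcode p) (qcode q))
  | QImp p q => Node (num 6) (Node (qcode p) (qcode q))
  end.

Definition ucode (s : usentence L) : tree :=
  let: Forall n q := s in Node (num n) (qcode q).

(** The words of length [k] over the alphabet [s], in lexicographic order. *)
Fixpoint words (T : Type) (s : seq T) (k : nat) : seq (seq T) :=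
  if k is j.+1 then [seq x :: w | x <- s, w <- words s j] else [:: [::]].

(** The list of the values of [h] on all [k]-tuples of elements of 'I_n.+1. *)
Definition table n k (h : ('I_k -> 'I_n.+1) -> nat) : tree :=
  tlist [seq num (h (fun i => nth ord0 w i)) | w <- words (enum 'I_n.+1) k].

Definition scode n (M : structure L 'I_n.+1) : tree :=
  Node (num n.+1)
    (Node (tlist [seq table (fint M f) | f : fun_sym L])
          (tlist [seq table (fun a => nat_of_bool (rint M r a))
                 | r : rel_sym L])).

End Codes.

Definition decidable_universal_consequences (L : signature) (T : class L) :
    Prop :=
  exists p, forall s : usentence L, decides p (ucode s) (consequence T s).

(** It is decidable whether a given finite structure is a model of [T0]: the
    sense in which a possibly infinite set [T0] of axioms is effectively given.
    This holds whenever [T0] is finitely axiomatized.  For locally finite [T0]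
    with computable bound it is necessary for the decidability of the universal
    consequences of [T0] itself, and mere recursiveness of [T0] as a set of
    axioms does not imply it. *)
Definition finite_models_decidable (L : signature) (T0 : utheory L) : Prop :=
  exists p, forall n (M : structure L 'I_n.+1),
    decides p (scode M) (models T0 M).

(** * The ordered structures *)

(** Binary operations and relations as functions of two arguments; meaningful
    for symbols of arity 2. *)
Definition args2 (A : Type) k (x y : A) : 'I_k -> A :=
  fun i => if val i == 0 then x else y.

Definition fint2 (L : signature) (A : Type) (M : structure L A) (f : fun_sym L)
    (x y : A) : A :=
  fint M f (@args2 A (farity f) x y).

Definition rint2 (L : signature) (A : Type) (M : structure L A)
    (r : rel_sym L) : rel A :=
  fun x y => rint M r (@args2 A (rarity r) x y).

Definition args0 (A : Type) : 'I_0 -> A :=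
  fun i => False_rect A (notF (ltn_ord i)).

Definition is_lattice (A : Type) (jn mt : A -> A -> A) : Prop :=
  [/\ commutative jn, associative jn, commutative mt, associative mt
    & (forall x y, jn x (mt x y) = x) /\ (forall x y, mt x (jn x y) = x)].

Definition is_distributive_lattice (A : Type) (jn mt : A -> A -> A) : Prop :=
  is_lattice jn mt /\ left_distributive mt jn.

Definition is_boolean_algebra (A : Type) (jn mt : A -> A -> A) (cp : A -> A)
    (bot top : A) : Prop :=
  is_distributive_lattice jn mt /\
  [/\ left_id bot jn, left_id top mt, right_inverse top cp jn
    & right_inverse bot cp mt].

Definition is_semilattice (A : Type) (op : A -> A -> A) : Prop :=
  [/\ commutative op, associative op & idempotent_op op].

(** The language whose function and relation symbols have the listed arities. *)
Definition sig_of (fs rs : seq nat) : signature :=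
  @Signature 'I_(size fs) (fun f => nth 0 fs f)
             'I_(size rs) (fun r => nth 0 rs r).

(** Join, meet, complement, bottom, top. *)
Definition boolean_sig : signature := sig_of [:: 2; 2; 1; 0; 0] [::].
Definition ba_join : fun_sym boolean_sig := @Ordinal 5 0 isT.
Definition ba_meet : fun_sym boolean_sig := @Ordinal 5 1 isT.
Definition ba_compl : fun_sym boolean_sig := @Ordinal 5 2 isT.
Definition ba_bot : fun_sym boolean_sig := @Ordinal 5 3 isT.
Definition ba_top : fun_sym boolean_sig := @Ordinal 5 4 isT.

Definition boolean_algebras : class boolean_sig := fun A M =>
  is_boolean_algebra (fint2 M ba_join) (fint2 M ba_meet)
    (fun x => fint M ba_compl (fun=> x))
    (fint M ba_bot (@args0 A)) (fint M ba_top (@args0 A)).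

Definition lattice_sig : signature := sig_of [:: 2; 2] [::].
Definition lat_join : fun_sym lattice_sig := @Ordinal 2 0 isT.
Definition lat_meet : fun_sym lattice_sig := @Ordinal 2 1 isT.

Definition distributive_lattices : class lattice_sig := fun A M =>
  is_distributive_lattice (fint2 M lat_join) (fint2 M lat_meet).

Definition semilattice_sig : signature := sig_of [:: 2] [::].
Definition sl_op : fun_sym semilattice_sig := @Ordinal 1 0 isT.

Definition semilattices : class semilattice_sig := fun A M =>
  is_semilattice (fint2 M sl_op).

Definition poset_sig : signature := sig_of [::] [:: 2].
Definition po_le : rel_sym poset_sig := @Ordinal 1 0 isT.

Definition posets : class poset_sig := fun A M =>
  [/\ reflexive (rint2 M po_le), antisymmetric (rint2 M po_le)
    & transitive (rint2 M po_le)].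

(** The universal theory [T0] is a theory of lattices, with join [jn] and
    meet [mt]; its language may contain further symbols. *)
Definition theory_of_lattices (L : signature) (T0 : utheory L)
    (jn mt : fun_sym L) : Prop :=
  [/\ farity jn = 2, farity mt = 2
    & forall (A : Type) (M : structure L A), inhabited A -> models T0 M ->
      is_lattice (fint2 M jn) (fint2 M mt)].

(** The order, as a relation definable in each of the languages. *)
Definition order_of (L : signature) : Type :=
  forall A : Type, structure L A -> A -> A -> Prop.

Definition le_of_join (L : signature) (jn : fun_sym L) : order_of L :=
  fun A M x y => fint2 M jn x y = y.

Definition le_of_meet (L : signature) (mt : fun_sym L) : order_of L :=
  fun A M x y => fint2 M mt x y = x.

Definition le_of_rel (L : signature) (r : rel_sym L) : order_of L :=
  fun A M x y => rint2 M r x y.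

(** * The conditions on the additional operations *)

Inductive condition : Type :=
  | A1e | A1c | A2 | A2e | A2c | A3
  | B1 | B1e | B1c | B2 | B3 | B4 | B5
  | C1 (i j : nat)
  | C2 (i j h : nat).

(** [cond_wf n c]: the condition [c] makes sense for an [n]-ary operation. *)
Definition cond_wf (n : nat) (c : condition) : bool :=
  match c with
  | C1 i j => (0 < n) && (i + j <= n)
  | C2 i j h => [&& 0 < n, i + j <= n & h <= i]
  | _ => n == 1
  end.

Section Conditions.
Variables (A : Type) (le : A -> A -> Prop).

Definition extensive (K : A -> A) := forall x, le x (K x).
Definition contractive (K : A -> A) := forall x, le (K x) x.
Definition idem (K : A -> A) := forall x, K (K x) = K x.
Definition isotone (K : A -> A) := forall x y, le x y -> le (K x) (K y).
Definition antitone (K : A -> A) := forall x y, le x y -> le (K y) (K x).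

Definition differ_only_at n (k : 'I_n) (x y : 'I_n -> A) : Prop :=
  forall l, l != k -> x l = y l.

Definition isotone_antitone (i j n : nat) (F : ('I_n -> A) -> A) : Prop :=
  (forall (k : 'I_n) (x y : 'I_n -> A), k < i -> differ_only_at k x y ->
     le (x k) (y k) -> le (F x) (F y)) /\
  (forall (k : 'I_n) (x y : 'I_n -> A), n - j <= k -> differ_only_at k x y ->
     le (x k) (y k) -> le (F y) (F x)).

Definition cond_holds (n : nat) (c : condition) (F : ('I_n -> A) -> A) : Prop :=
  let K := fun x : A => F (fun=> x) in
  match c with
  | A1e => extensive K
  | A1c => contractive K
  | A2 => idem K
  | A2e => idem K /\ extensive K
  | A2c => idem K /\ contractive K
  | A3 => involutive K
  | B1 => isotone K
  | B1e => isotone K /\ extensive K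
  | B1c => isotone K /\ contractive K
  | B2 => isotone K /\ idem K
  | B3 => [/\ isotone K, extensive K & idem K]
  | B4 => [/\ isotone K, contractive K & idem K]
  | B5 => antitone K
  | C1 i j => isotone_antitone i j F
  | C2 i j h => isotone_antitone i j F /\
      (forall (k : 'I_n) (x : 'I_n -> A), k < h -> le (x k) (F x))
  end.

End Conditions.

Inductive lterm (n : nat) : Type :=
  | LVar of 'I_n
  | LJoin of lterm n & lterm n
  | LMeet of lterm n & lterm n.

Fixpoint lterm_vars_lt n (i : nat) (t : lterm n) : bool :=
  match t with
  | LVar k => k < i
  | LJoin s u => lterm_vars_lt i s && lterm_vars_lt i u
  | LMeet s u => lterm_vars_lt i s && lterm_vars_lt i u
  end.

Fixpoint lterm_eval n (A : Type) (jn mt : A -> A -> A) (x : 'I_n -> A)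
    (t : lterm n) : A :=
  match t with
  | LVar k => x k
  | LJoin s u => jn (lterm_eval jn mt x s) (lterm_eval jn mt x u)
  | LMeet s u => mt (lterm_eval jn mt x s) (lterm_eval jn mt x u)
  end.

(** The conditions available over lattices, for an [n]-ary operation. *)
Inductive lcondition (n : nat) : Type :=
  | LCond of condition
  | C3 (i j : nat) of lterm n.

Definition lcond_wf n (c : lcondition n) : bool :=
  match c with
  | LCond c => cond_wf n c
  | C3 i j t => [&& 0 < n, i + j <= n & lterm_vars_lt i t]
  end.

Definition lcond_holds (A : Type) (le : A -> A -> Prop) (jn mt : A -> A -> A)
    n (c : lcondition n) (F : ('I_n -> A) -> A) : Prop :=
  match c with
  | LCond c => cond_holds le c F
  | C3 i j t => isotone_antitone le i j F /\
      (forall x : 'I_n -> A, le (lterm_eval jn mt x t) (F x))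
  end.

(** * Extensions by finitely many operations *)

(** The language [L] with new operations indexed by [I], of arities [ar]. *)
Definition ext_sig (L : signature) (I : finType) (ar : I -> nat) : signature :=
  @Signature (fun_sym L + I)%type
    (fun f => match f with inl f => farity f | inr o => ar o end)
    (rel_sym L) (@rarity L).

Section Extensions.
Variables (L : signature) (I : finType) (ar : I -> nat).

Definition reduct (A : Type) (M : structure (ext_sig L ar) A) : structure L A :=
  @Structure L A (fun f => fint M (inl f)) (fun r => rint M r).

Definition new_op (A : Type) (M : structure (ext_sig L ar) A) (o : I) :
    ('I_(ar o) -> A) -> A :=
  fint M (inr o).

Definition ordered_extension (T : class L) (le : order_of L)
    (c : I -> condition) : class (ext_sig L ar) :=
  fun A M => T A (reduct M) /\
    forall o, cond_holds (le A (reduct M)) (c o) (@new_op A M o).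

Definition lattice_extension (T : class L) (jn mt : fun_sym L)
    (c : forall o, lcondition (ar o)) : class (ext_sig L ar) :=
  fun A M => T A (reduct M) /\
    forall o, lcond_holds (le_of_meet mt (reduct M))
      (fint2 (reduct M) jn) (fint2 (reduct M) mt) (c o) (@new_op A M o).

End Extensions.

(* Main.v *)
From HB Require Import structures.
From mathcomp Require Import all_boot boolp.
From Stdlib Require List.
Require Import Defs.

Set Implicit Arguments.
Unset Strict Implicit.
Unset Printing Implicit Defensive.

(** Why the theorem holds.  If a universal sentence fails in an extended model
    [M], it fails because of the finitely many values that its subterms take.
    Build a finite model [N] that contains a copy of these values, with the same
    order and with the same results of operations whenever argument and result
    are among them: the sentence fails in [N] too.  The size of [N] is bounded
    by a computable function of the sentence, so it is enough to look through
    the finitely many structures up to that size.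

    The ordered reduct of [N].  For lattices it is the substructure generated
    by the values, finite by the bound on generated models.  For posets and
    semilattices it is the power set of {0, ..., m-1}, in which elements [a_i],
    [i < m], are represented by sending [x] to the set of the [i] with
    [a_i <= x] (which preserves meets) or with [~ (x <= a_i)] (which preserves
    joins).  In every case the order of [N] is a complete lattice, even when [N]
    is only used as a poset or as a semilattice.

    The new operations ([extend_lcondition]).  An operation of [M] induces a
    partial one on [N], to be made total without losing the required condition.
    Conditions without monotonicity hold for the extension by the identity.
    Otherwise put [G c] = sup of the known values [F d] with [d] below [c], below
    meaning pointwise smaller in the isotone arguments and larger in the antitone
    ones; forced lower bounds ([c] itself for an extensive operation, [t(c)] in
    condition [C3]) are added to the supremum.  Idempotence is obtained by
    replacing [G c] with the least pre-fixpoint of [G] above it.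

    Distributive lattices and Boolean algebras are locally finite theories of
    lattices: an element generated by [k] elements is determined by the meets of
    generators that lie below it, hence at most [2 ^ 2 ^ k] elements; for Boolean
    algebras one adds the complements of the generators and the two constants.

    The search ([bounded_countermodels_decidable]) is a program over trees.  The
    recursion scheme on both subtrees suffices to enumerate the codes of all
    structures of a given size, and to evaluate a sentence in a structure.  The
    conditions on the operations are themselves finitely many universal
    sentences, so the same evaluator decides whether a finite structure
    satisfies them. *)

(** * Programs on trees *)

Lemma tree_comparable : comparable tree.
Proof. by rewrite /comparable /decidable; decide equality. Qed.

HB.instance Definition _ := hasDecEq.Build tree (compareP tree_comparable).

Definition lft (t : tree) : tree := if t is Node a _ then a else Leaf.
Definition rgt (t : tree) : tree := if t is Node _ b then b else Leaf.

(** Total computability.  Functions of several arguments are handled as families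
    [fun x => f (a x) (b x)] over one tree [x], which plays the role of the
    environment; each closure lemma below has this shape, so that a program is
    found by following the syntax of the function ([comp]). *)
Definition computed (f : tree -> tree) : Prop :=
  exists p, forall x, run p x (f x).

Lemma computed_leaf : computed (fun=> Leaf).
Proof. by exists PLeaf. Qed.

Lemma computed_id : computed id.
Proof. by exists PId. Qed.

Lemma computed_comp f g : computed f -> computed g -> computed (fun x => f (g x)).
Proof. by move=> [p pP] [q qP]; exists (PComp p q) => x; exists (g x). Qed.

Lemma computed_lft f : computed f -> computed (fun x => lft (f x)).
Proof. by apply: (computed_comp (f := lft)); exists PLeft => -[]. Qed.

Lemma computed_rgt f : computed f -> computed (fun x => rgt (f x)).
Proof. by apply: (computed_comp (f := rgt)); exists PRight => -[]. Qed.

Lemma computed_node f g :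
  computed f -> computed g -> computed (fun x => Node (f x) (g x)).
Proof.
by move=> [p pP] [q qP]; exists (PNode p q) => x; exists (f x), (g x).
Qed.

Lemma computed_const t : computed (fun=> t).
Proof.
by elim: t => [|a IHa b IHb]; [apply: computed_leaf | apply: computed_node].
Qed.

Fixpoint trec (b : tree) (s : tree -> tree -> tree -> tree -> tree)
    (t : tree) : tree :=
  if t is Node l r then s l r (trec b s l) (trec b s r) else b.

(** The step function may depend on the environment [x]: [PRec] passes along
    its left argument, for which [x] itself is taken. *)
Lemma computed_trec b s t : computed b -> computed t ->
  computed (fun y => s (lft (lft y)) (lft (rgt (lft y))) (rgt (rgt (lft y)))
                       (lft (rgt y)) (rgt (rgt y))) ->
  computed (fun x => trec (b x) (s x) (t x)).
Proof.
move=> [pb pbP] [pt ptP] [q qP].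
exists (PComp (PRec pb q) (PNode PId pt)) => x.
exists (Node x (t x)); first by exists x, (t x).
rewrite /=; elim: (t x) => [|l IHl r IHr] /=; first exact: pbP.
exists (trec (b x) (s x) l), (trec (b x) (s x) r); split=> //.
Qed.


#[local] Hint Resolve computed_id computed_const computed_node computed_lft
  computed_rgt : comp.
#[local] Hint Extern 5 (computed (fun x => trec _ _ _)) =>
  apply: computed_trec : comp.

Ltac comp := cbv beta; auto 60 with comp nocore.

(** Zero, coded by a leaf, counts as false and every node as true. *)
Definition tif (c a b : tree) : tree := trec b (fun _ _ _ _ => a) c.

Lemma computed_tif c a b : computed c -> computed a -> computed b ->
  computed (fun x => tif (c x) (a x) (b x)).
Proof.
move=> cC aC bC; apply: computed_trec => //.
apply: (computed_comp aC); comp.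
Qed.
#[local] Hint Resolve computed_tif : comp.


#[local] Hint Extern 4 (computed (fun x => ?f (@?g x))) =>
  match goal with H : computed f |- _ => apply: (computed_comp H) end : comp.

(** Unary numbers are lists of leaves, so this is both the fold over a list and
    the iteration of a function. *)
Definition tfold (b : tree) (s : tree -> tree -> tree) (l : tree) : tree :=
  trec b (fun a _ _ r => s a r) l.

Lemma computed_tfold b s l : computed b -> computed l ->
  computed (fun y => s (lft y) (lft (rgt y)) (rgt (rgt y))) ->
  computed (fun x => tfold (b x) (s x) (l x)).
Proof.
move=> bC lC sC; apply: computed_trec => //.
pose g y := Node (lft (lft y)) (Node (lft (rgt (lft y))) (rgt (rgt y))).
have gC : computed g by rewrite /g; comp.
exact: (computed_comp sC gC).
Qed.
#[local] Hint Extern 3 (computed (fun x => tfold _ _ _)) =>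
  apply: computed_tfold : comp.

Lemma tfold_tlist b s l : tfold b s (tlist l) = foldr s b l.
Proof. by elim: l => //= a l; rewrite /tfold /= => ->. Qed.

Lemma tfold_num b s n : tfold b s (num n) = iter n (s Leaf) b.
Proof. by elim: n => //= n; rewrite /tfold /= => ->. Qed.

Definition tadd (a b : tree) : tree := tfold b (fun _ r => Node Leaf r) a.

Lemma computed_tadd a b :
  computed a -> computed b -> computed (fun x => tadd (a x) (b x)).
Proof. by move=> aC bC; rewrite /tadd; comp. Qed.
#[local] Hint Resolve computed_tadd : comp.

Lemma tadd_num m n : tadd (num m) (num n) = num (m + n).
Proof. by rewrite /tadd tfold_num; elim: m => //= m ->. Qed.

Definition tmul (a b : tree) : tree := tfold Leaf (fun _ r => tadd b r) a.

Lemma computed_tmul a b :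
  computed a -> computed b -> computed (fun x => tmul (a x) (b x)).
Proof. by move=> aC bC; rewrite /tmul; comp. Qed.
#[local] Hint Resolve computed_tmul : comp.

Lemma tmul_num m n : tmul (num m) (num n) = num (m * n).
Proof.
by rewrite /tmul tfold_num; elim: m => //= m ->; rewrite tadd_num mulSn.
Qed.

Definition texp (a b : tree) : tree := tfold (num 1) (fun _ r => tmul a r) b.

Lemma computed_texp a b :
  computed a -> computed b -> computed (fun x => texp (a x) (b x)).
Proof. by move=> aC bC; rewrite /texp; comp. Qed.
#[local] Hint Resolve computed_texp : comp.

Lemma texp_num m n : texp (num m) (num n) = num (m ^ n).
Proof.
by rewrite /texp tfold_num; elim: n => //= n ->; rewrite tmul_num expnS.
Qed.

Definition tsub (a b : tree) : tree := tfold a (fun _ r => rgt r) b.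

Lemma computed_tsub a b :
  computed a -> computed b -> computed (fun x => tsub (a x) (b x)).
Proof. by move=> aC bC; rewrite /tsub; comp. Qed.
#[local] Hint Resolve computed_tsub : comp.

Lemma tsub_num m n : tsub (num m) (num n) = num (m - n).
Proof.
rewrite /tsub tfold_num; elim: n => [|n /= ->]; first by rewrite subn0.
by rewrite subnS; case: (m - n).
Qed.

Definition tnot (a : tree) : tree := tif a Leaf (num 1).

Lemma computed_tnot a : computed a -> computed (fun x => tnot (a x)).
Proof. by move=> aC; rewrite /tnot; comp. Qed.
#[local] Hint Resolve computed_tnot : comp.

Lemma tif_num (b : bool) x y : tif (num b) x y = if b then x else y.
Proof. by case: b. Qed.

Definition teqn (a b : tree) : tree := tnot (tadd (tsub a b) (tsub b a)).

Lemma computed_teqn a b :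
  computed a -> computed b -> computed (fun x => teqn (a x) (b x)).
Proof. by move=> aC bC; rewrite /teqn; comp. Qed.
#[local] Hint Resolve computed_teqn : comp.

Lemma teqn_num m n : teqn (num m) (num n) = num (m == n).
Proof.
rewrite /teqn !tsub_num tadd_num eqn_leq -!subn_eq0 -addn_eq0.
by case: (_ + _).
Qed.

Definition tnth (l i : tree) : tree := lft (tfold l (fun _ r => rgt r) i).

Lemma computed_tnth l i :
  computed l -> computed i -> computed (fun x => tnth (l x) (i x)).
Proof. by move=> lC iC; rewrite /tnth; comp. Qed.
#[local] Hint Resolve computed_tnth : comp.

Lemma tnth_tlist s i : tnth (tlist s) (num i) = nth Leaf s i.
Proof.
rewrite /tnth tfold_num; elim: i s => [|i IH] [|a s] //=.
  by have ->: iter i rgt Leaf = Leaf by elim: i {IH} => //= i ->.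
by rewrite -IH -iterS iterSr.
Qed.

Definition tmap (F : tree -> tree) (l : tree) : tree :=
  tfold Leaf (fun a r => Node (F a) r) l.

Lemma computed_tmap F l : computed l ->
  computed (fun y => F (lft y) (rgt y)) ->
  computed (fun x => tmap (F x) (l x)).
Proof.
move=> lC FC; apply: computed_tfold; [comp | comp |].
apply: computed_node; last by comp.
pose g y := Node (lft y) (lft (rgt y)).
have gC : computed g by rewrite /g; comp.
exact: (computed_comp FC gC).
Qed.
#[local] Hint Extern 3 (computed (fun x => tmap _ _)) =>
  apply: computed_tmap : comp.

Lemma tmap_tlist F s : tmap F (tlist s) = tlist (map F s).
Proof. by rewrite /tmap tfold_tlist; elim: s => //= a s ->. Qed.

Definition tcat (a b : tree) : tree := tfold b Node a.

Lemma computed_tcat a b :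
  computed a -> computed b -> computed (fun x => tcat (a x) (b x)).
Proof. by move=> aC bC; rewrite /tcat; comp. Qed.
#[local] Hint Resolve computed_tcat : comp.

Lemma tcat_tlist s t : tcat (tlist s) (tlist t) = tlist (s ++ t).
Proof. by rewrite /tcat tfold_tlist; elim: s => //= a s ->. Qed.

Definition tflatten (l : tree) : tree := tfold Leaf tcat l.

Lemma computed_tflatten l : computed l -> computed (fun x => tflatten (l x)).
Proof. by move=> lC; rewrite /tflatten; comp. Qed.
#[local] Hint Resolve computed_tflatten : comp.

Lemma tflatten_tlist ss :
  tflatten (tlist (map tlist ss)) = tlist (flatten ss).
Proof.
by rewrite /tflatten tfold_tlist; elim: ss => //= s ss ->; rewrite tcat_tlist.
Qed.

Definition tall (P : tree -> tree) (l : tree) : tree :=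
  tfold (num 1) (fun a r => tif (P a) r Leaf) l.

Lemma computed_tall P l : computed l ->
  computed (fun y => P (lft y) (rgt y)) ->
  computed (fun x => tall (P x) (l x)).
Proof.
move=> lC PC; apply: computed_tfold; [comp | comp |].
apply: computed_tif; [|comp|comp].
pose g y := Node (lft y) (lft (rgt y)).
have gC : computed g by rewrite /g; comp.
exact: (computed_comp PC gC).
Qed.
#[local] Hint Extern 3 (computed (fun x => tall _ _)) =>
  apply: computed_tall : comp.

Lemma tall_tlist P s :
  tall P (tlist s) = num (all (fun x => P x != Leaf) s).
Proof.
rewrite /tall tfold_tlist; elim: s => //= a s ->.
by case: eqP; case: (P a).
Qed.

(** The numbers [n-1, ..., 0]: recursion over a number supplies its predecessors
    in decreasing order, and the order is immaterial below. *)
Definition tdown (n : tree) : tree := trec Leaf (fun _ k _ r => Node k r) n.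

Lemma computed_tdown n : computed n -> computed (fun x => tdown (n x)).
Proof. by move=> nC; rewrite /tdown; comp. Qed.
#[local] Hint Resolve computed_tdown : comp.

Lemma tdown_num n : tdown (num n) = tlist (map num (rev (iota 0 n))).
Proof.
elim: n => // n IH; rewrite -addn1 iotaD rev_cat /= -IH addn1.
by rewrite /tdown /=.
Qed.

Definition tnseq (n x : tree) : tree := tfold Leaf (fun _ r => Node x r) n.

Lemma computed_tnseq n a :
  computed n -> computed a -> computed (fun x => tnseq (n x) (a x)).
Proof. by move=> nC aC; rewrite /tnseq; comp. Qed.
#[local] Hint Resolve computed_tnseq : comp.

Lemma tnseq_num n x : tnseq (num n) x = tlist (nseq n x).
Proof. by rewrite /tnseq tfold_num; elim: n => //= n ->. Qed.

(** All the choices of one entry in each list. *)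
Definition prods (T : Type) (ss : seq (seq T)) : seq (seq T) :=
  foldr (fun s ws => [seq x :: w | x <- s, w <- ws]) [:: [::]] ss.

Lemma wordsE (T : Type) (s : seq T) k : words s k = prods (nseq k s).
Proof. by elim: k => //= k ->. Qed.

Definition tprods (l : tree) : tree :=
  tfold (Node Leaf Leaf)
    (fun s ws => tflatten (tmap (fun x => tmap (fun w => Node x w) ws) s)) l.

Lemma computed_tprods l : computed l -> computed (fun x => tprods (l x)).
Proof. by move=> lC; rewrite /tprods; comp. Qed.
#[local] Hint Resolve computed_tprods : comp.

Lemma tprods_tlist ss :
  tprods (tlist (map tlist ss)) = tlist (map tlist (prods ss)).
Proof.
rewrite /tprods tfold_tlist; elim: ss => //= s ss ->.
rewrite tmap_tlist map_flatten -tflatten_tlist -!map_comp.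
congr (tflatten (tlist _)); apply: eq_map => x /=.
by rewrite tmap_tlist -!map_comp.
Qed.

(** The value of a digit string to base [b], paired with [b] to the power of the
    length, so that the fold does not need the length of the remaining string. *)
Definition thorner (b l : tree) : tree :=
  tfold (Node Leaf (num 1))
    (fun a r => Node (tadd (tmul a (rgt r)) (lft r)) (tmul b (rgt r))) l.

Lemma computed_thorner b l :
  computed b -> computed l -> computed (fun x => thorner (b x) (l x)).
Proof. by move=> bC lC; rewrite /thorner; comp. Qed.
#[local] Hint Resolve computed_thorner : comp.

Fixpoint horner (b : nat) (l : seq nat) : nat :=
  if l is a :: l' then a * b ^ size l' + horner b l' else 0.

Lemma thorner_num b l :
  thorner (num b) (tlist (map num l)) = Node (num (horner b l)) (num (b ^ size l)).
Proof.
rewrite /thorner tfold_tlist; elim: l => //= a l ->.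
by rewrite /= !tmul_num tadd_num expnS.
Qed.

Definition tsize (t : tree) : tree :=
  trec Leaf (fun _ _ m n => Node Leaf (tadd m n)) t.

Fixpoint nodes (t : tree) : nat :=
  if t is Node a b then (nodes a + nodes b).+1 else 0.

Lemma computed_tsize t : computed t -> computed (fun x => tsize (t x)).
Proof. by move=> tC; rewrite /tsize; comp. Qed.
#[local] Hint Resolve computed_tsize : comp.

Lemma tsizeE t : tsize t = num (nodes t).
Proof. by elim: t => //= a IHa b IHb; rewrite /tsize /= -tadd_num -IHa -IHb. Qed.

Lemma computed_tlist_map (T : Type) (F : T -> tree -> tree) (s : seq T) :
  (forall i, computed (F i)) -> computed (fun x => tlist [seq F i x | i <- s]).
Proof.
by move=> FC; elim: s => [|i s IH] /=; [comp | apply: computed_node].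
Qed.

(* words *)

Lemma mem_prods (T : eqType) (J : Type) (S : J -> seq T) (js : seq J) w :
  w \in prods [seq S j | j <- js] <->
  size w = size js /\ forall x0 j0 i, i < size js -> nth x0 w i \in S (nth j0 js i).
Proof.
elim: js w => [|j js IH] w /=.
  by rewrite inE; split=> [/eqP-> | [/size0nil-> _]].
split=> [/allpairsP[[x u] /= [xS /IH[szu uS] ->]] | [szw wS]].
  by split=> [/=|x0 j0 [|i] //=]; [rewrite szu | apply: uS].
case: w szw wS => //= x u [szu] wS; apply/allpairsP; exists (x, u); split=> //=.
  exact: (wS x j 0).
by apply/IH; split=> // x0 j0 i; apply: (wS x0 j0 i.+1).
Qed.

(** Choices indexed by a finite type are functions: this turns the enumerations
    of tables, of structures and of valuations into quantifications. *)
Lemma mem_prods_enum (T : eqType) (J : finType) (S : J -> seq T) w :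
  w \in prods [seq S j | j <- enum J] <->
  exists phi : J -> T, (forall j, phi j \in S j) /\ w = [seq phi j | j <- enum J].
Proof.
rewrite mem_prods; split=> [[szw wS] | [phi [phiS ->]]]; last first.
  rewrite size_map; split=> // x0 j0 i lti.
  by rewrite (nth_map j0).
case: w szw wS => [|x0 w] szw wS.
  have J0 (j : J) : False by have := mem_enum J j; rewrite (size0nil (esym szw)).
  exists (fun j => False_rect _ (J0 j)); split=> [j|]; first by case: (J0 j).
  by rewrite (size0nil (esym szw)).
exists (fun j => nth x0 (x0 :: w) (index j (enum J))); split=> [j|].
  have := wS x0 j (index j (enum J)); rewrite nth_index ?mem_enum //.
  by apply; rewrite index_mem mem_enum.
apply: (@eq_from_nth _ x0) => [|i lti]; first by rewrite size_map.
have [j0 _] : exists j0 : J, True.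
  case: (enum J) szw => [|j0 e] // _; by exists j0.
rewrite (nth_map j0) -?szw //= index_uniq ?enum_uniq -?szw //.
Qed.

Lemma mem_words (T : eqType) (s : seq T) k w :
  w \in words s k <->
  exists phi : 'I_k -> T, (forall i, phi i \in s) /\ w = [seq phi i | i <- enum 'I_k].
Proof.
rewrite wordsE.
have ->: nseq k s = [seq s | i <- enum 'I_k] by rewrite -[k in LHS]card_ord cardE; elim: (enum _) => //= i e ->.
exact: mem_prods_enum.
Qed.

(** * Evaluating sentences in finite structures *)

Lemma nth_flatten_block (T : Type) (x0 : T) (ss : seq (seq T)) c i j :
  all (fun s => size s == c) ss -> j < c ->
  nth x0 (flatten ss) (i * c + j) = nth x0 (nth [::] ss i) j.
Proof.
elim: ss i => [|s ss IH] i; first by rewrite !nth_nil.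
rewrite /= nth_cat => /andP[/eqP-> szc] ltjc.
case: i => [|i]; first by rewrite mul0n add0n ltjc.
rewrite mulSn -addnA ltnNge leq_addr /= addKn.
exact: IH.
Qed.

Lemma size_words (T : Type) (s : seq T) k : size (words s k) = size s ^ k.
Proof. by elim: k => //= k IH; rewrite size_allpairs IH expnS. Qed.

Lemma horner_lt b l : all (fun a => a < b) l -> horner b l < b ^ size l.
Proof.
elim: l => [|a l IH] //= /andP[ltab /IH ltl].
rewrite expnS; apply: (@leq_trans (a.+1 * b ^ size l)).
  by rewrite mulSn addnC ltn_add2r.
by rewrite leq_mul2r ltab orbT.
Qed.

(** The lexicographic position of a word is its value as a numeral, which makes
    the value table of an operation addressable by arithmetic. *)
Lemma nth_words n k (w : seq 'I_n.+1) : size w = k ->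
  nth [::] (words (enum 'I_n.+1) k) (horner n.+1 (map val w)) = w.
Proof.
elim: w k => [|a w IH] [|k] //= [szw].
rewrite /allpairs size_map szw.
have hw : horner n.+1 (map val w) < n.+1 ^ k.
  rewrite -szw -(size_map val) horner_lt //.
  by apply/allP => x /mapP[y _ ->]; apply: ltn_ord.
rewrite nth_flatten_block //; last first.
  by apply/allP => s /mapP[x _ ->]; rewrite size_map size_words size_enum_ord.
rewrite (nth_map ord0) ?size_enum_ord // nth_ord_enum.
by rewrite (nth_map [::]) ?IH // size_words size_enum_ord.
Qed.

Definition tlookup (b tab args : tree) : tree := tnth tab (lft (thorner b args)).

Lemma computed_tlookup b tab args :
  computed b -> computed tab -> computed args ->
  computed (fun x => tlookup (b x) (tab x) (args x)).
Proof. by move=> bC tC aC; rewrite /tlookup; comp. Qed.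
#[local] Hint Resolve computed_tlookup : comp.

Lemma tlookup_table n k (h : ('I_k -> 'I_n.+1) -> nat) (a : 'I_k -> 'I_n.+1) :
  tlookup (num n.+1) (table h) (tlist [seq num (a i) | i <- enum 'I_k]) =
  num (h a).
Proof.
pose w := [seq a i | i <- enum 'I_k].
have szw : size w = k by rewrite size_map size_enum_ord.
have -> : [seq num (a i) | i <- enum 'I_k] = map num (map val w).
  by rewrite -!map_comp.
rewrite /tlookup thorner_num /= /table tnth_tlist (nth_map [::]).
  rewrite nth_words //; congr (num (h _)); apply: funext => i.
  by rewrite (nth_map i) ?size_enum_ord // nth_ord_enum.
rewrite size_words size_enum_ord -[X in _ ^ X]szw -(size_map val) horner_lt //.
by apply/allP => x /mapP[y _ ->]; apply: ltn_ord.
Qed.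

(** The recursion has access to the two subtrees only, while the arguments of a
    function symbol are a list further down.  Hence every tree is evaluated in
    two ways at once: as a term (left component), and as a list of terms (right
    component). *)
Definition tterm (S v t : tree) : tree :=
  trec (Node Leaf Leaf)
    (fun a b ra rb =>
       Node (tif a (tlookup (lft S) (tnth (lft (rgt S)) (lft b)) (rgt (rgt rb)))
                   (tnth v b))
            (Node (lft ra) (rgt rb))) t.

Lemma computed_tterm S v t :
  computed S -> computed v -> computed t ->
  computed (fun x => tterm (S x) (v x) (t x)).
Proof. by move=> SC vC tC; rewrite /tterm; comp. Qed.
#[local] Hint Resolve computed_tterm : comp.

Lemma tterm_tlist S v l :
  rgt (tterm S v (tlist l)) = tlist [seq lft (tterm S v t) | t <- l].
Proof. by elim: l => //= t l ->. Qed.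

Section Evaluation.
Variables (L : signature) (n : nat) (M : structure L 'I_n.+1).

Definition vcode m (v : 'I_m -> 'I_n.+1) : tree :=
  tlist [seq num (v i) | i <- enum 'I_m].

Lemma nth_codom_rank (J : finType) (F : J -> tree) (j : J) :
  nth Leaf [seq F i | i <- enum J] (enum_rank j) = F j.
Proof.
rewrite (nth_map j); first by rewrite nth_enum_rank.
by rewrite -cardE ltn_ord.
Qed.

Lemma tterm_tcode m (v : 'I_m -> 'I_n.+1) (t : term L m) :
  lft (tterm (scode M) (vcode v) (tcode t)) = num (teval M v t).
Proof.
elim: t => [i|f a IH] /=.
  rewrite tnth_tlist (nth_map i) ?size_enum_ord //.
  by rewrite (@nth_ord_enum _ i i).
have -> : rgt (tterm (scode M) (vcode v)
            (tlist [seq tcode (a i) | i <- enum 'I_(farity f)])) =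
          tlist [seq num (teval M v (a i)) | i <- enum 'I_(farity f)].
  by rewrite tterm_tlist -map_comp; congr tlist; apply: eq_map => i /=.
rewrite tnth_tlist (nth_codom_rank (fun f => table (fint M f))).
exact: tlookup_table.
Qed.
End Evaluation.

(** The operands of a binary connective are grandchildren of the node that
    carries it, so the result for a node also records the results for its two
    children.  The nested tests decode the constructor number. *)
Definition tqfree (S v q : tree) : tree :=
  trec Leaf
    (fun a b ra rb =>
      let l := lft (rgt rb) in let r := rgt (rgt rb) in
      Node
       (tif a (tif (rgt a) (tif (rgt (rgt a)) (tif (rgt (rgt (rgt a)))
          (tif (rgt (rgt (rgt (rgt a)))) (tif (rgt (rgt (rgt (rgt (rgt a)))))
            (tif l r (num 1))
            (tif l (num 1) r))
            (tif l r Leaf))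
            (tnot (lft rb)))
            Leaf)
            (tlookup (lft S) (tnth (rgt (rgt S)) (lft b))
               (rgt (tterm S v (rgt b)))))
            (teqn (lft (tterm S v (lft b))) (lft (tterm S v (rgt b)))))
       (Node (lft ra) (lft rb))) q.

Lemma computed_tqfree S v q :
  computed S -> computed v -> computed q ->
  computed (fun x => tqfree (S x) (v x) (q x)).
Proof. by move=> SC vC qC; rewrite /tqfree; comp. Qed.
#[local] Hint Resolve computed_tqfree : comp.

Section FormulaEvaluation.
Variables (L : signature) (n : nat) (M : structure L 'I_n.+1).

Lemma tqfree_qcode m (v : 'I_m -> 'I_n.+1) (q : qfree L m) :
  lft (tqfree (scode M) (vcode v) (qcode q)) = num `[< qholds M v q >].
Proof.
elim: q => [s t|r a||p IHp|p IHp q IHq|p IHp q IHq|p IHp q IHq].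
- rewrite /= /tif /= !tterm_tcode teqn_num; congr (num (nat_of_bool _)).
  by apply/eqP/asboolP => [/val_inj|->].
- rewrite /= /tif /= tterm_tlist -map_comp.
  rewrite tnth_tlist
    (nth_codom_rank (fun r => table (fun a => nat_of_bool (rint M r a)))).
  under eq_map => i do rewrite /= tterm_tcode.
  by rewrite tlookup_table asboolb.
- by rewrite /= /tif /= asboolF.
- by rewrite /= /tif /= -/(tif _ _ _) IHp asbool_neg; case: `[< _ >].
- by rewrite /= /tif /= -/(tif _ _ _) IHp IHq tif_num asbool_and; case: `[< _ >].
- by rewrite /= /tif /= -/(tif _ _ _) IHp IHq tif_num asbool_or; case: `[< _ >].
- rewrite /= /tif /= -/(tif _ _ _) IHp IHq tif_num asbool_imply.
  by case: `[< _ >].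
Qed.
End FormulaEvaluation.

(** Truth for all valuations, which are the words over the universe. *)
Definition tholds (S u : tree) : tree :=
  tall (fun v => lft (tqfree S v (rgt u)))
       (tprods (tnseq (lft u) (tdown (lft S)))).

Lemma computed_tholds S u :
  computed S -> computed u -> computed (fun x => tholds (S x) (u x)).
Proof. by move=> SC uC; rewrite /tholds; comp. Qed.
#[local] Hint Resolve computed_tholds : comp.

Lemma tholds_ucode L n (M : structure L 'I_n.+1) (s : usentence L) :
  tholds (scode M) (ucode s) = num `[< holds M s >].
Proof.
case: s => m q; rewrite /tholds /= -[Node Leaf (num n)]/(num n.+1).
rewrite tdown_num tnseq_num -map_nseq tprods_tlist -wordsE.
rewrite tall_tlist; congr (num (nat_of_bool _)).
apply/allP/asboolP => [all_v v | M_s x /mapP[w /mem_words[phi [phiP ->]] ->]].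
  suff /all_v : vcode v \in [seq tlist w | w <- words [seq num i | i <- rev (iota 0 n.+1)] m].
    by rewrite tqfree_qcode; case: asboolP => // _ /eqP[].
  apply: map_f; apply/mem_words; exists (fun i => num (v i)); split=> // i.
  by rewrite map_f // mem_rev mem_iota /= ltn_ord.
have /choice[v vP] i : exists k : 'I_n.+1, phi i = num k.
  have /mapP[k] := phiP i; rewrite mem_rev mem_iota => /andP[_ ltkn] ->.
  by exists (Ordinal ltkn).
under eq_map => i do rewrite vP.
rewrite -/(vcode v) tqfree_qcode.
by have /asboolP-> := M_s v; apply/eqP.
Qed.

(** * Searching for a countermodel *)

Lemma mem_words_all (T : eqType) (s : seq T) k w :
  (w \in words s k) = (size w == k) && all [in s] w.
Proof.
elim: k w => [|k IH] [|x w] //=.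
  by apply/negP => /allpairsP[[y u] /= [_ _]].
rewrite eqSS andbCA -IH; apply/allpairsP/andP => [[[y u] /= [ys us [-> ->]]] //|].
by case=> xs ws; exists (x, w).
Qed.

Lemma words_uniq (T : eqType) (s : seq T) k : uniq s -> uniq (words s k).
Proof.
move=> us; elim: k => //= k IH.
by apply: allpairs_uniq => // -[x u] [y v] _ _ /= [-> ->].
Qed.

Definition ttables (N b : tree) (k : nat) : tree :=
  tprods (tnseq (texp N (num k)) (tdown b)).

Lemma computed_ttables N b k : computed N -> computed b ->
  computed (fun x => ttables (N x) (b x) k).
Proof. by move=> NC bC; rewrite /ttables; comp. Qed.
#[local] Hint Resolve computed_ttables : comp.

Definition tables n b k : seq tree :=
  map tlist (words (map num (rev (iota 0 b))) (n.+1 ^ k)).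

Lemma ttables_num n b k : ttables (num n.+1) (num b) k = tlist (tables n b k).
Proof.
by rewrite /ttables texp_num tdown_num tnseq_num -map_nseq tprods_tlist -wordsE.
Qed.

(** Every word of the right length is the table of a function: the argument tuple
    is looked up among the words that enumerate the tuples. *)
Lemma mem_tables n b k x :
  x \in tables n b.+1 k <->
  exists h : ('I_k -> 'I_n.+1) -> 'I_b.+1, x = table h.
Proof.
set ws := words (enum 'I_n.+1) k.
have szws : size ws = n.+1 ^ k by rewrite size_words size_enum_ord.
split=> [/mapP[y] | [h ->]].
  rewrite mem_words_all => /andP[/eqP szy /allP y_nums ->].
  have {}y_nums j : j < n.+1 ^ k -> exists m : 'I_b.+1, nth Leaf y j = num m.
    rewrite -szy => /(mem_nth Leaf) /y_nums /mapP[m].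
    by rewrite mem_rev mem_iota => /andP[_ ltm] ->; exists (Ordinal ltm).
  have rk_lt (a : 'I_k -> 'I_n.+1) : index [seq a i | i <- enum 'I_k] ws < n.+1 ^ k.
    rewrite -szws index_mem mem_words_all size_map size_enum_ord eqxx /=.
    by apply/allP => z _; rewrite mem_enum.
  have /choice[h hP] a := y_nums _ (rk_lt a).
  exists h; congr tlist.
  apply: (@eq_from_nth _ Leaf) => [|j]; rewrite szy ?size_map ?szws // => ltj.
  rewrite (nth_map [::]) ?szws // -hP.
  set w := nth [::] ws j.
  have ww : w \in ws by rewrite mem_nth ?szws.
  have -> : [seq nth ord0 w (val i) | i <- enum 'I_k] = w.
    move: ww; rewrite mem_words_all => /andP[/eqP szw _].
    rewrite -[RHS](mkseq_nth ord0) szw /mkseq -val_enum_ord -map_comp.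
    exact: eq_map.
  by rewrite index_uniq ?words_uniq ?enum_uniq ?szws.
apply: map_f; rewrite mem_words_all size_map szws eqxx andTb.
apply/allP => z /mapP[w _ ->]; apply: (map_f num).
by rewrite mem_rev mem_iota; apply: ltn_ord.
Qed.

Section Structures.
Variable L : signature.

Definition tstructures (N : tree) : tree :=
  tflatten (tmap (fun F => tmap (fun R => Node N (Node F R))
      (tprods (tlist [seq ttables N (num 2) (rarity r) | r <- enum (rel_sym L)])))
    (tprods (tlist [seq ttables N N (farity f) | f <- enum (fun_sym L)]))).

Lemma computed_tstructures N : computed N -> computed (fun x => tstructures (N x)).
Proof.
move=> NC.
have RC : computed (fun x =>
    tlist [seq ttables (N x) (num 2) (rarity r) | r <- enum (rel_sym L)]).
  by apply: (computed_tlist_map (F := fun r x => ttables (N x) _ (rarity r))) => r; comp.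
have FC : computed (fun x =>
    tlist [seq ttables (N x) (N x) (farity f) | f <- enum (fun_sym L)]).
  by apply: (computed_tlist_map (F := fun f x => ttables (N x) _ (farity f))) => r; comp.
apply: computed_tflatten; apply: computed_tmap; first exact: computed_tprods.
apply: (computed_tmap (F := fun y R => Node (N (lft y)) (Node (rgt y) R))).
  by apply: computed_tprods; apply: (computed_comp RC); comp.
by comp.
Qed.

Lemma tstructuresP n : exists2 cs, tstructures (num n.+1) = tlist cs &
  forall x, x \in cs <-> exists M : structure L 'I_n.+1, x = scode M.
Proof.
pose Fs := map tlist (prods [seq tables n n.+1 (farity f) | f <- enum (fun_sym L)]).
pose Rs := map tlist (prods [seq tables n 2 (rarity r) | r <- enum (rel_sym L)]).
exists [seq Node (num n.+1) (Node F R) | F <- Fs, R <- Rs].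
  have tabE (J : finType) (ar : J -> nat) b :
      [seq ttables (num n.+1) (num b) (ar j) | j <- enum J] =
      map tlist [seq tables n b (ar j) | j <- enum J].
    by rewrite -map_comp; apply: eq_map => j; apply: ttables_num.
  rewrite /tstructures !tabE !tprods_tlist -/Fs -/Rs -tflatten_tlist.
  rewrite tmap_tlist -map_comp; congr (tflatten (tlist _)).
  by apply: eq_map => F /=; rewrite tmap_tlist.
move=> x; split=> [/allpairsP[[F R] /= [/mapP[f fP ->] /mapP[r rP ->] ->]] | [M ->]].
  have [phi [/= phiP ->]] := (mem_prods_enum _ _).1 fP.
  have [rho [/= rhoP ->]] := (mem_prods_enum _ _).1 rP.
  have hP s : exists h : ('I_(farity s) -> 'I_n.+1) -> 'I_n.+1, phi s = table h.
    by apply/mem_tables/phiP.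
  have kP s : exists h : ('I_(rarity s) -> 'I_n.+1) -> 'I_2, rho s = table h.
    by apply/mem_tables/rhoP.
  exists (@Structure L _ (fun s => sval (cid (hP s)))
                         (fun s a => sval (cid (kP s)) a == 1 :> nat)).
  rewrite /scode; congr (Node _ (Node (tlist _) (tlist _))).
    by apply: eq_map => s /=; case: cid.
  apply: eq_map => s /=; case: cid => /= h ->.
  congr tlist; apply: eq_map => w; congr num.
  by case: (h _) => -[|[|?]].
apply/allpairsP.
exists (tlist [seq table (fint M f) | f : fun_sym L],
        tlist [seq table (fun a => nat_of_bool (rint M r a)) | r : rel_sym L]).
split=> //=; apply: map_f; apply/mem_prods_enum.
  by exists (fun f => table (fint M f)); split=> // f; apply/mem_tables; exists (fint M f).
exists (fun r => table (fun a => nat_of_bool (rint M r a))); split=> // r.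
apply/mem_tables; exists (fun a => inord (rint M r a)).
congr tlist; apply: eq_map => w; rewrite inordK //.
by case: rint.
Qed.

Definition tcodes (N : tree) : tree :=
  tflatten (tmap (fun k => tstructures (Node Leaf k)) (tdown N)).

Lemma computed_tcodes N : computed N -> computed (fun x => tcodes (N x)).
Proof.
move=> NC; rewrite /tcodes; apply: computed_tflatten.
by apply: computed_tmap => //; [comp | apply: computed_tstructures; comp].
Qed.

(** The list consists of codes of genuine structures only.  This matters because
    the program that recognizes the models of a theory is only known to halt on
    such codes. *)
Lemma tcodesP N : exists2 cs, tcodes (num N) = tlist cs &
  forall x, x \in cs <->
    exists n (M : structure L 'I_n.+1), n < N /\ x = scode M.
Proof.
have /choice[css cssP] n : exists cs, tstructures (num n.+1) = tlist cs /\
    forall x, x \in cs <-> exists M : structure L 'I_n.+1, x = scode M.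
  by have [cs] := tstructuresP n; exists cs.
exists (flatten [seq css n | n <- rev (iota 0 N)]).
  rewrite /tcodes tdown_num tmap_tlist -map_comp -tflatten_tlist -map_comp.
  by congr (tflatten (tlist _)); apply: eq_map => n /=; have [<-] := cssP n.
move=> x; split=> [/flatten_mapP[n] | [n [M [ltnN ->]]]].
  rewrite mem_rev mem_iota => /andP[_ ltnN] /(cssP n).2[M ->].
  by exists n, M.
apply/flatten_mapP; exists n; first by rewrite mem_rev mem_iota.
by apply/(cssP n).2; exists M.
Qed.

End Structures.

Lemma decidesE p x P : decides p x P <-> run p x (num `[< P >]).
Proof.
split=> [[yes no] | runP].
  by case: asboolP => [/yes | /no].
by split=> H; move: runP; [rewrite asboolT | rewrite asboolF].
Qed.

(** The program [p] may diverge on trees that are not codes, so it cannot be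
    mapped over the list by structural recursion, which would also run it on
    subtrees of the codes.  Instead the loop runs over the positions in the list:
    a number has no subtrees but numbers and leaves, and at each step [p] is run
    on one entry. *)
Lemma run_all (p : prog) : exists P, forall (U : Type) (code : U -> tree)
    (d h : pred U) u (Ms : seq U),
  (forall M, run p (code M) (num (d M))) ->
  (forall M, tholds (code M) u = num (h M)) ->
  run P (Node u (tlist (map code Ms))) (num (all (fun M => d M ==> h M) Ms)).
Proof.
pose cd y := tnth (rgt (lft (lft y))) (rgt (rgt (lft y))).
have [pc pcP] : computed cd by rewrite /cd; comp.
pose comb z := tif (rgt z)
  (tif (tholds (cd (lft z)) (lft (lft (lft (lft z))))) (rgt (rgt (lft z))) Leaf)
  (rgt (rgt (lft z))).
have [pm pmP] : computed comb by rewrite /comb /cd; comp.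
have [pl plP] : computed (fun x => tmap (fun=> Leaf) (rgt x)) by comp.
pose q := PComp pm (PNode PId (PComp p pc)).
exists (PComp (PRec (PNode PLeaf PLeaf) q) (PNode PId pl)).
move=> U code d h u Ms dP hP /=; set e := Node u _.
exists (Node e (num (size Ms))).
  exists e, (num (size Ms)); split=> //.
  suff -> : num (size Ms) = tmap (fun=> Leaf) (rgt e) by apply: plP.
  by rewrite tmap_tlist -map_comp; elim: (Ms) => //= M s ->.
suff main k : k <= size Ms ->
    run (PRec (PNode PLeaf PLeaf) q) (Node e (num k))
        (num (all (fun M => d M ==> h M) (take k Ms))).
  by have := main _ (leqnn _); rewrite take_size.
elim: k => [|k IH] lek; first by rewrite take0; exists Leaf, Leaf.
have {}IH := IH (ltnW lek).
exists (num 1), (num (all (fun M => d M ==> h M) (take k Ms))); split=> //.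
  by exists Leaf, Leaf.
have M0 : U by case: (Ms) lek.
set y := Node _ _.
exists (Node y (num (d (nth M0 Ms k)))).
  exists y, (num (d (nth M0 Ms k))); split=> //.
  exists (code (nth M0 Ms k)); last exact: dP.
  by have := pcP y; rewrite /cd /= tnth_tlist (nth_map M0).
have := pmP (Node y (num (d (nth M0 Ms k)))).
rewrite /comb /cd /= tnth_tlist (nth_map M0) // hP !tif_num.
rewrite (take_nth M0) // all_rcons /=.
by case: (d _); case: (h _).
Qed.

(** Structures with the same code are equal only up to extensionality; choosing
    [M0] whenever the code is that of [M0] avoids comparing them. *)
Lemma seq_of_codes (U : Type) (code : U -> tree) cs M0 :
  (forall x, x \in cs -> exists M, x = code M) -> code M0 \in cs ->
  exists2 Ms, cs = map code Ms & forall P : pred U, all P Ms -> P M0.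
Proof.
move=> csP M0cs.
have /choice[f fP] x : exists M, x \in cs -> x = code M /\ (x = code M0 -> M = M0).
  have [->|xM0] := EM (x = code M0); first by exists M0.
  have [/csP[M xM] | //] := boolP (x \in cs); last by exists M0.
  by exists M.
exists (map f cs) => [|P].
  rewrite -map_comp -[LHS]map_id; apply/eq_in_map => x xcs /=.
  exact: (fP x xcs).1.
rewrite all_map => /allP/(_ _ M0cs) /=.
by rewrite ((fP _ M0cs).2 erefl).
Qed.

(** The bound depends on the number of nodes of the code of the sentence, which
    exceeds the number of its subterms. *)
Theorem bounded_countermodels_decidable (L : signature) (T : class L) (g : nat -> nat) :
  computable g ->
  (exists p, forall n (M : structure L 'I_n.+1), decides p (scode M) (T _ M)) ->
  (forall s, ~ consequence T s -> exists n (M : structure L 'I_n.+1),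
     [/\ n < g (nodes (ucode s)), T _ M & ~ holds M s]) ->
  decidable_universal_consequences T.
Proof.
move=> [pg pgP] [p pP] bnd.
have [P PP] := run_all p.
have [pc pcP] : computed (fun x => tcodes L x) by apply: computed_tcodes; comp.
have [ps psP] : computed (fun x => tsize x) by comp.
exists (PComp P (PNode PId (PComp pc (PComp pg ps)))) => s.
have [cs csE csP] := tcodesP L (g (nodes (ucode s))).
have run_list y : run P (Node (ucode s) (tlist cs)) y ->
    run (PComp P (PNode PId (PComp pc (PComp pg ps)))) (ucode s) y.
  move=> runP; exists (Node (ucode s) (tlist cs)) => //.
  exists (ucode s), (tlist cs); split=> //.
  exists (num (g (nodes (ucode s)))); last by rewrite -csE; apply: pcP.
  by exists (num (nodes (ucode s))); [rewrite -tsizeE; apply: psP | apply: pgP].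
pose U := {n & structure L 'I_n.+1}.
pose pack n M : U := Tagged (fun n => structure L 'I_n.+1) (M : structure L 'I_n.+1).
pose code (M : U) := scode (tagged M).
pose d (M : U) := `[< T _ (tagged M) >]; pose h (M : U) := `[< holds (tagged M) s >].
have dP M : run p (code M) (num (d M)) by apply/decidesE/pP.
have hP M : tholds (code M) (ucode s) = num (h M) by apply: tholds_ucode.
have codeP x : x \in cs -> exists M, x = code M.
  by move=> /csP[n [M [_ ->]]]; exists (pack _ M).
split=> [Ts | /bnd[n [M [ltn TM nMs]]]]; apply: run_list.
  have [Ms ->] : exists Ms, cs = map code Ms.
    elim: (cs) codeP => [|x xs IH] xsP; first by exists [::].
    have [|Ms ->] := IH; first by move=> y ys; apply: xsP; rewrite inE ys orbT.
    by have [|M ->] := xsP x; [rewrite inE eqxx | exists (M :: Ms)].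
  have := PP _ code d h _ Ms dP hP.
  suff -> : all (fun M => d M ==> h M) Ms by [].
  elim: Ms => //= M Ms ->; rewrite andbT; apply/implyP => /asboolP TM.
  by apply/asboolP; exact: (Ts _ _ (inhabits ord0) TM).
have Mcs : code (pack _ M) \in cs by apply/csP; exists n, M.
have [Ms -> allM] := seq_of_codes codeP Mcs; have := PP _ code d h _ Ms dP hP.
suff -> : all (fun M => d M ==> h M) Ms = false by [].
by apply/negP => /allM /implyP; rewrite /d /h /= !asboolE => /(_ TM).
Qed.

Definition satisfies (L : signature) (A : Type) (M : structure L A)
    (S : seq (usentence L)) : Prop :=
  all (fun s => `[< holds M s >]) S.

Lemma enum_sum (I J : finType) :
  enum {: I + J} = [seq inl i | i <- enum I] ++ [seq inr j | j <- enum J].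
Proof. by rewrite !enumT [in LHS]unlock. Qed.

(** In the code of an extended structure the tables of the old symbols come first,
    so the code of the reduct is obtained by truncating the list of tables. *)
Lemma extension_models_decidable (L : signature) (T0 : utheory L) (I : finType)
    (ar : I -> nat) (S : seq (usentence (ext_sig L ar))) :
  finite_models_decidable T0 ->
  exists p, forall n (M : structure (ext_sig L ar) 'I_n.+1),
    decides p (scode M) (models T0 (reduct M) /\ satisfies M S).
Proof.
move=> [p0 p0P].
pose k := #|fun_sym L|.
pose red (x : tree) := Node (lft x)
  (Node (tlist [seq tnth (lft (rgt x)) (num i) | i <- iota 0 k]) (rgt (rgt x))).
have redE n (M : structure (ext_sig L ar) 'I_n.+1) : red (scode M) = scode (reduct M).
  rewrite /red /scode /=; congr (Node _ (Node (tlist _) _)).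
  set s := [seq _ | f : _ + _].
  rewrite -[RHS](mkseq_nth Leaf) size_map -cardE -/k.
  apply/eq_in_map => i; rewrite mem_iota => /andP[_ ltik].
  rewrite tnth_tlist /s /image_mem enum_sum.
  rewrite map_cat nth_cat -!map_comp size_map -!enumT -cardE (ltik : i < k).
  by [].
have [pr prP] : computed red.
  rewrite /red; apply: computed_node; first by comp.
  apply: computed_node; last by comp.
  by apply: (computed_tlist_map (F := fun i x => tnth (lft (rgt x)) (num i))) => i; comp.
pose comb z := tif (rgt z)
  (tall (fun u => tholds (lft z) u) (tlist (map (@ucode _) S))) Leaf.
have [pm pmP] : computed comb by rewrite /comb; comp.
exists (PComp pm (PNode PId (PComp p0 pr))) => n M; apply/decidesE.
exists (Node (scode M) (num `[< models T0 (reduct M) >])).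
  exists (scode M), (num `[< models T0 (reduct M) >]); split=> //.
  by exists (scode (reduct M)); [rewrite -redE; apply: prP | apply/decidesE/p0P].
have -> : num `[< models T0 (reduct M) /\ satisfies M S >] =
    comb (Node (scode M) (num `[< models T0 (reduct M) >])).
  rewrite /comb /= tif_num tall_tlist all_map asbool_and /satisfies asboolb.
  case: `[< _ >] => //=; congr (num (nat_of_bool _)); apply: eq_all => s /=.
  by rewrite tholds_ucode; case: `[< _ >]; [symmetry; apply/eqP|rewrite eqxx].
exact: pmP.
Qed.

(** * Extending partial operations to complete lattices *)

Definition partial_order (A : Type) (le : A -> A -> Prop) : Prop :=
  [/\ forall x, le x x, forall x y, le x y -> le y x -> x = y
    & forall y x z, le x y -> le y z -> le x z].

Definition is_lub (A : Type) (le : A -> A -> Prop) (S : A -> Prop) (u : A) :=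
  (forall x, S x -> le x u) /\ (forall y, (forall x, S x -> le x y) -> le u y).

Definition complete (A : Type) (le : A -> A -> Prop) : Prop :=
  forall S : A -> Prop, exists u, is_lub le S u.

(** The comparison under which an operation isotone in the first [i] and antitone
    in the last [j] arguments is monotone; the other arguments are kept fixed. *)
Definition below (A : Type) (le : A -> A -> Prop) (i j n : nat)
    (x y : 'I_n -> A) : Prop :=
  forall k : 'I_n, [/\ k < i -> le (x k) (y k), n - j <= k -> le (y k) (x k)
                     & i <= k -> k < n - j -> x k = y k].

(** The hypothesis varies one argument at a time, so [x] is changed into [y]
    through the hybrid tuples [h p], which agree with [y] before position [p]. *)
Lemma isotone_antitone_below (A : Type) (le : A -> A -> Prop) i j n
    (F : ('I_n -> A) -> A) x y : partial_order le ->
  isotone_antitone le i j F -> below le i j x y -> le (F x) (F y).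
Proof.
move=> [lexx _ le_trans] [Fi Fj] xy.
pose h p k := if (k : 'I_n) < p then y k else x k.
suff hP p : p <= n -> le (F x) (F (h p)).
  have -> : y = h n by apply: funext => k; rewrite /h ltn_ord.
  exact: hP.
elim: p => [_|p IH ltpn]; first by have -> : h 0 = x by apply: funext.
apply: le_trans (IH (ltnW ltpn)) _; pose k := Ordinal ltpn.
have hh : differ_only_at k (h p) (h p.+1).
  move=> l lk; have /negPf lp : val l != p := lk.
  by rewrite /h ltnS (leq_eqVlt l) lp.
have hk : h p k = x k by rewrite /h ltnn.
have hk1 : h p.+1 k = y k by rewrite /h ltnSn.
have [xyi xyj xym] := xy k.
have [ki|ik] := ltnP k i; first by apply: (Fi k) => //; rewrite hk hk1; apply: xyi.
have [kj|jk] := leqP (n - j) k.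
  apply: (Fj k) => // [l lk|]; first by rewrite hh.
  by rewrite hk hk1; apply: xyj.
suff -> : h p = h p.+1 by [].
apply: funext => l; have [->|/hh //] := eqVneq l k.
by rewrite hk hk1 xym.
Qed.

(** [X] is the set of elements of [A] that are represented in [C], by [iota]. *)
Section Extend.
Variables (A : Type) (leA : A -> A -> Prop) (C : Type) (leC : C -> C -> Prop).
Variables (X : A -> Prop) (iota : A -> C).
Hypothesis poA : partial_order leA.
Hypothesis poC : partial_order leC.
Hypothesis complC : complete leC.
Hypothesis emb : forall x y, X x -> X y -> (leA x y <-> leC (iota x) (iota y)).

Let lexx : forall x, leC x x. Proof. by case: poC. Qed.
Let le_anti : forall x y, leC x y -> leC y x -> x = y. Proof. by case: poC. Qed.
Let le_trans : forall y x z, leC x y -> leC y z -> leC x z.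
Proof. by case: poC. Qed.

Lemma iota_inj x y : X x -> X y -> iota x = iota y -> x = y.
Proof.
move=> Xx Xy e; case: poA => _ anti _.
by apply: anti; apply/emb => //; rewrite e.
Qed.

Lemma complete_glb (S : C -> Prop) :
  exists u, (forall x, S x -> leC u x) /\ (forall y, (forall x, S x -> leC y x) -> leC y u).
Proof.
have [u [ub lub]] := complC (fun z => forall x, S x -> leC z x).
exists u; split=> [x Sx|y yS]; last exact: ub.
by apply: lub => z; apply.
Qed.

Section Unary.
Variable K : A -> A.

Definition agree1 (G : C -> C) : Prop :=
  forall x, X x -> X (K x) -> G (iota x) = iota (K x).

(** For the conditions that only relate [x], [K x] and [K (K x)], a point outside
    the known part can be fixed.  If [x] and [K x] are both in [X] and [K] is
    idempotent or involutive, then so is [K (K x)], and the extension agrees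
    with [K] at both points. *)
Lemma extend_by_identity : exists G : C -> C, agree1 G /\
  forall c, G c = c \/ exists x, [/\ X x, X (K x), iota x = c & G c = iota (K x)].
Proof.
have /choice[G GP] c : exists u,
    (forall x, X x -> X (K x) -> iota x = c -> u = iota (K x)) /\
    (u = c \/ exists x, [/\ X x, X (K x), iota x = c & u = iota (K x)]).
  have [[x [Xx XKx xc]]|noX] := EM (exists x, [/\ X x, X (K x) & iota x = c]).
    exists (iota (K x)); split=> [y Xy _ yc|]; last by right; exists x.
    by rewrite (iota_inj Xy Xx) ?yc.
  by exists c; split=> [x Xx XKx xc|]; [case: noX; exists x | left].
by exists G; split=> [x Xx XKx|c]; [apply: (GP _).1 | apply: (GP c).2].
Qed.

(** The flag [e] asks for extensiveness and [r] for idempotence.  Let [g c] be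
    the supremum of the known values at points below [c], and of [c] if [e].  If
    [K] is idempotent, then [g c <= g (g c)], because a value [K x] occurring in
    the supremum is itself a known point below [g c], with [K (K x) = K x].  The
    least pre-fixpoint [f c] of [g] above [g c] is then idempotent; it is still
    isotone, and it agrees with [K] since [K x] is a pre-fixpoint.  Without [r],
    [f] is just [g]. *)
Lemma extend_isotone1 (e r : bool) : isotone leA K ->
  (e -> extensive leA K) -> (r -> idem K) ->
  exists G, [/\ agree1 G, isotone leC G, e -> extensive leC G,
    ~~ e -> contractive leA K -> contractive leC G & r -> idem G].
Proof.
move=> Kiso Kext Kidem.
pose S c u := (e /\ u = c) \/
  exists x, [/\ X x, X (K x), leC (iota x) c & u = iota (K x)].
have /choice[g gP] c := complC (S c).
have g_ge c u : S c u -> leC u (g c) := (gP c).1 u.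
have g_le c y : (forall u, S c u -> leC u y) -> leC (g c) y := (gP c).2 y.
have g_iso c c' : leC c c' -> leC (g c) (g c').
  move=> cc'; apply: g_le => u [[eT ->]|[x [Xx XKx xc ->]]].
    by apply: le_trans cc' _; apply: g_ge; left.
  by apply: g_ge; right; exists x; split=> //; apply: le_trans xc cc'.
have g_gg c : r -> leC (g c) (g (g c)).
  move=> rT; apply: g_le => u [[eT ->]|[x [Xx XKx xc ->]]].
    by apply: (@le_trans (g c)); apply: g_ge; left.
  apply: (g_ge); right; exists (K x); rewrite Kidem //; split=> //.
  by apply: g_ge; right; exists x.
pose P c y := leC (g c) y /\ (r -> leC (g y) y).
have /choice[f fP] c := complete_glb (P c).
have f_le c y : P c y -> leC (f c) y := (fP c).1 y.
have f_ge c z : (forall y, P c y -> leC z y) -> leC z (f c) := (fP c).2 z.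
have g_f c : leC (g c) (f c) by apply: f_ge => y [].
have f_fix c : r -> leC (g (f c)) (f c).
  move=> rT; apply: f_ge => y [gcy gyy]; apply: le_trans (gyy rT).
  by apply: g_iso; apply: f_le.
exists f; split.
- move=> x Xx XKx; apply: le_anti; last first.
    by apply: le_trans (g_f _); apply: g_ge; right; exists x.
  apply: f_le; split=> [|rT]; apply: g_le => u [[eT ->]|[y [Xy XKy yx ->]]] //.
  + by apply/emb => //; apply: Kext.
  + by apply/emb => //; apply: Kiso; apply/emb.
  + by apply/emb => //; rewrite -(Kidem rT x); apply: Kiso; apply/emb.
- move=> c c' cc'; apply: f_ge => y [gy gyy]; apply: f_le; split=> //.
  exact: le_trans (g_iso _ _ cc') gy.
- by move=> eT c; apply: le_trans (g_f c); apply: g_ge; left.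
- move=> /negP ne Kc c; have gc d : leC (g d) d.
    apply: g_le => u [[/ne//]|[x [Xx XKx xd ->]]].
    by apply: le_trans xd; apply/emb.
  by apply: f_le; split.
- move=> rT c; apply: le_anti.
    by apply: f_le; split=> [|_]; apply: f_fix.
  apply: f_ge => y [gfy gyy]; apply: f_le; split=> //.
  apply: le_trans (g_gg c rT) (le_trans _ gfy).
  by apply: g_iso.
Qed.

Lemma extend_antitone1 : antitone leA K ->
  exists2 G, agree1 G & antitone leC G.
Proof.
move=> Kanti.
have /choice[g gP] c := complC (fun u =>
  exists x, [/\ X x, X (K x), leC c (iota x) & u = iota (K x)]).
exists g => [x Xx XKx|c c' cc'].
  apply: le_anti; last by apply: (gP _).1; exists x.
  apply: (gP _).2 => u [y [Xy XKy xy ->]].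
  by apply/emb => //; apply: Kanti; apply/emb.
apply: (gP _).2 => u [x [Xx XKx c'x ->]]; apply: (gP _).1.
by exists x; split=> //; apply: le_trans cc' c'x.
Qed.

End Unary.

Section Nary.
Variables (n : nat) (F : ('I_n -> A) -> A).

Definition agree (G : ('I_n -> C) -> C) : Prop :=
  forall x, (forall k, X (x k)) -> X (F x) -> G (fun k => iota (x k)) = iota (F x).

Lemma below_refl i j (c : 'I_n -> C) : below leC i j c c.
Proof. by move=> k; split. Qed.

Lemma below_trans i j (c d e : 'I_n -> C) :
  below leC i j c d -> below leC i j d e -> below leC i j c e.
Proof.
move=> cd de k; have [c1 c2 c3] := cd k; have [d1 d2 d3] := de k.
split=> [ki|kj|ki kj]; last by rewrite c3 ?d3.
  by apply: le_trans (c1 ki) (d1 ki).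
by apply: le_trans (d2 kj) (c2 kj).
Qed.

(** [base c] is a set of lower bounds imposed on the value at [c]; it must grow
    with [c] and respect the values that are already known. *)
Lemma extend_isotone_antitone i j (base : ('I_n -> C) -> C -> Prop) :
  i + j <= n -> isotone_antitone leA i j F ->
  (forall c d u, below leC i j c d -> base c u -> exists2 w, base d w & leC u w) ->
  (forall x u, (forall k, X (x k)) -> X (F x) ->
     base (fun k => iota (x k)) u -> leC u (iota (F x))) ->
  exists G, [/\ agree G, isotone_antitone leC i j G
              & forall c u, base c u -> leC u (G c)].
Proof.
move=> ijn FP base_mono base_le.
pose S c u := base c u \/ exists x,
  [/\ forall k, X (x k), X (F x), below leC i j (fun k => iota (x k)) c & u = iota (F x)].
have /choice[G GP] c := complC (S c).
have G_mono c d : below leC i j c d -> leC (G c) (G d).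
  move=> cd; apply: (GP c).2 => u [/(base_mono _ _ _ cd)[w dw uw]|[x [Xx XF xc ->]]].
    by apply: le_trans uw _; apply: (GP d).1; left.
  by apply: (GP d).1; right; exists x; split=> //; apply: below_trans xc cd.
exists G; split; last by move=> c u cu; apply: (GP c).1; left.
  move=> x Xx XF; apply: le_anti; last first.
    by apply: (GP _).1; right; exists x; split=> //; apply: below_refl.
  apply: (GP _).2 => u [/base_le|[y [Xy XFy yx ->]]]; first exact.
  apply/emb => //; apply: (isotone_antitone_below poA FP) => k.
  have [y1 y2 y3] := yx k; split=> [ki|kj|ki kj].
  - by apply/emb => //; apply: y1.
  - by apply/emb => //; apply: y2.
  - by apply: iota_inj => //; apply: y3.
have iLE : i <= n - j by rewrite -(addnK j i) leq_sub2r.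
split=> k c d kij cd cdk; apply: G_mono => l; have [->|lk] := eqVneq l k.
- split=> // [kj|ik]; last by rewrite leqNgt kij in ik.
  by rewrite leqNgt (leq_trans kij iLE) in kj.
- by rewrite cd.
- split=> // [ki|_ kj]; last by rewrite ltnNge kij in kj.
  by have := leq_trans ki iLE; rewrite ltnNge kij.
- by rewrite cd.
Qed.

End Nary.

Lemma agree_unary (F : ('I_1 -> A) -> A) G :
  agree1 (fun x => F (fun=> x)) G -> agree F (fun c => G (c ord0)).
Proof.
move=> Gagree x Xx XF.
have xE : x = fun=> x ord0 by apply: funext => k; rewrite ord1.
by rewrite Gagree // -?xE.
Qed.

(** Each condition is met by one of the constructions above.  A contractive
    operation needs no lower bounds: known values at points below [c] are then
    themselves below [c]. *)
Lemma extend_condition n (F : ('I_n -> A) -> A) c :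
  cond_wf n c -> cond_holds leA c F ->
  exists2 G, agree F G & cond_holds leC c G.
Proof.
have unary : ~~ (if c is (C1 _ _ | C2 _ _ _) then true else false) -> n = 1 ->
    cond_holds leA c F -> exists2 G, agree F G & cond_holds leC c G; last first.
  case: c unary => [||||||||||||| i j | i j h] unary cP;
    try exact: (unary isT (eqP cP)).
  - move: cP => /= /andP[_ ijn] FP.
    by have [||||G [GF GP _]] := @extend_isotone_antitone n F i j (fun _ _ => False); last exists G.
  - move: cP => /= /and3P[_ ijn hi] [FP Fext].
    have [|||| G [GF GP Gext]] := @extend_isotone_antitone n F i j
        (fun c u => exists2 k : 'I_n, k < h & u = c k) => //.
    + move=> c d u cd [k kh ->]; exists (d k); first by exists k.
      have [ck _ _] := cd k; apply: ck; exact: leq_trans kh hi.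
    + by move=> x u Xx XF [k kh ->]; apply/emb => //; apply: Fext.
    + by exists G => //; split=> // k x kh; apply: Gext; exists k.
move=> cP n1; subst n; set K := fun x => F (fun=> x).
have [I [IK IP]] := extend_by_identity K.
have iso e r := @extend_isotone1 K e r.
have IF := agree_unary IK.
have I_ext : extensive leA K -> extensive leC I.
  move=> KP x; have [->//|[y [Xy XKy <- ->]]] := IP x.
  by apply/emb => //; apply: KP.
have I_con : contractive leA K -> contractive leC I.
  move=> KP x; have [->//|[y [Xy XKy <- ->]]] := IP x.
  by apply/emb => //; apply: KP.
have I_idem : idem K -> idem I.
  move=> KP x; have [e|[y [Xy XKy <- ->]]] := IP x; first by rewrite !e.
  by rewrite (IK (K y)) ?KP.
case: c cP => [||||||||||||| i j | i j h] //= _.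
- by move=> KP; exists (fun c => I (c ord0)) => //; apply: I_ext.
- by move=> KP; exists (fun c => I (c ord0)) => //; apply: I_con.
- by move=> KP; exists (fun c => I (c ord0)) => //; apply: I_idem.
- move=> [K1 K2]; exists (fun c => I (c ord0)) => //.
  by split; [apply: I_idem | apply: I_ext].
- move=> [K1 K2]; exists (fun c => I (c ord0)) => //.
  by split; [apply: I_idem | apply: I_con].
- move=> KP; have KK y : K (K y) = y by apply: KP.
  exists (fun c => I (c ord0)) => // x.
  have [e|[y [Xy XKy <- e]]] := IP x; first by rewrite !e.
  by rewrite e -[in RHS](KK y); apply: IK; rewrite ?KK.
- move=> K1; have [//|//|//|G [GK G1 _ _ _]] := iso false false.
  by exists (fun c => G (c ord0)) => //; apply: agree_unary.
- move=> [K1 K2]; have [//|//|//|G [GK G1 G2 _ _]] := iso true false.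
  by exists (fun c => G (c ord0)); [apply: agree_unary | split=> //; apply: G2].
- move=> [K1 K2]; have [//|//|//|G [GK G1 _ G2 _]] := iso false false.
  by exists (fun c => G (c ord0)); [apply: agree_unary | split=> //; apply: G2].
- move=> [K1 K2]; have [//|//|//|G [GK G1 _ _ G2]] := iso false true.
  by exists (fun c => G (c ord0)); [apply: agree_unary | split=> //; apply: G2].
- move=> [K1 K2 K3]; have [//|//|//|G [GK G1 G2 _ G3]] := iso true true.
  exists (fun c => G (c ord0)); first exact: agree_unary.
  by split=> //; [apply: G2 | apply: G3].
- move=> [K1 K2 K3]; have [//|//|//|G [GK G1 _ G2 G3]] := iso false true.
  exists (fun c => G (c ord0)); first exact: agree_unary.
  by split=> //; [apply: G2 | apply: G3].
- move=> K1; have [//|G GK G1] := @extend_antitone1 K.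
  by exists (fun c => G (c ord0)) => //; apply: agree_unary.
Qed.

Variables (jnA mtA : A -> A -> A) (jnC mtC : C -> C -> C).
Hypothesis jn_mono : forall x y z t, leC x z -> leC y t -> leC (jnC x y) (jnC z t).
Hypothesis mt_mono : forall x y z t, leC x z -> leC y t -> leC (mtC x y) (mtC z t).
Hypothesis jn_emb : forall x y, X x -> X y ->
  X (jnA x y) /\ iota (jnA x y) = jnC (iota x) (iota y).
Hypothesis mt_emb : forall x y, X x -> X y ->
  X (mtA x y) /\ iota (mtA x y) = mtC (iota x) (iota y).

Lemma lterm_emb n (t : lterm n) x : (forall k, X (x k)) ->
  X (lterm_eval jnA mtA x t) /\
  iota (lterm_eval jnA mtA x t) = lterm_eval jnC mtC (fun k => iota (x k)) t.
Proof.
move=> Xx; elim: t => [k|s [Xs es] u [Xu eu]|s [Xs es] u [Xu eu]] //=.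
  by have [? ->] := jn_emb Xs Xu; rewrite es eu.
by have [? ->] := mt_emb Xs Xu; rewrite es eu.
Qed.

Lemma lterm_mono n i (t : lterm n) (c d : 'I_n -> C) : lterm_vars_lt i t ->
  (forall k : 'I_n, k < i -> leC (c k) (d k)) ->
  leC (lterm_eval jnC mtC c t) (lterm_eval jnC mtC d t).
Proof.
move=> ti cd; elim: t ti => [k|s IHs u IHu|s IHs u IHu] /=; first exact: cd.
  by move=> /andP[/IHs ? /IHu ?]; apply: jn_mono.
by move=> /andP[/IHs ? /IHu ?]; apply: mt_mono.
Qed.

(** Lattice terms are isotone, so the values of [t] are admissible lower bounds. *)
Lemma extend_lcondition n (F : ('I_n -> A) -> A) (c : lcondition n) :
  lcond_wf c -> lcond_holds leA jnA mtA c F ->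
  exists2 G, agree F G & lcond_holds leC jnC mtC c G.
Proof.
case: c => [c|i j t] /=; first exact: extend_condition.
move=> /and3P[_ ijn ti] [FP Ft].
have [|||| G [GF GP Gt]] := @extend_isotone_antitone n F i j
    (fun c u => u = lterm_eval jnC mtC c t) => //.
- move=> c d u cd ->; exists (lterm_eval jnC mtC d t) => //.
  by apply: lterm_mono ti _ => k ki; have [ck _ _] := cd k; apply: ck.
- move=> x u Xx XF ->; have [Xt <-] := lterm_emb t Xx.
  by apply/emb.
- by exists G => //; split=> // x; apply: Gt.
Qed.

End Extend.

(** * The conditions as universal sentences *)

Section Satisfies.
Variables (L : signature) (A : Type) (M : structure L A).

Lemma satisfies1 s : satisfies M [:: s] <-> holds M s.
Proof. by rewrite /satisfies /= andbT; split=> /asboolP. Qed.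

Lemma satisfies_cat S S' :
  satisfies M (S ++ S') <-> satisfies M S /\ satisfies M S'.
Proof. by rewrite /satisfies all_cat; split=> /andP. Qed.

Lemma satisfies_cons s S :
  satisfies M (s :: S) <-> holds M s /\ satisfies M S.
Proof. by rewrite -cat1s satisfies_cat satisfies1. Qed.

Lemma satisfies_map (J : finType) (P : pred J) (F : J -> usentence L) :
  satisfies M [seq F j | j <- enum J & P j] <-> forall j, P j -> holds M (F j).
Proof.
rewrite /satisfies all_map; split=> [/allP FP j Pj | FP].
  by apply/asboolP; apply: FP; rewrite mem_filter Pj mem_enum.
by apply/allP => j; rewrite mem_filter => /andP[Pj _]; apply/asboolP/FP.
Qed.

Lemma satisfies_flatten (J : finType) (F : J -> seq (usentence L)) :
  satisfies M (flatten [seq F j | j <- enum J]) <-> forall j, satisfies M (F j).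
Proof.
have -> : satisfies M (flatten [seq F j | j <- enum J]) =
    all (fun j => `[< satisfies M (F j) >]) (enum J).
  rewrite /satisfies; congr is_true; elim: (enum J) => //= j e.
  by rewrite all_cat asboolb => ->.
split=> [/allP FP j | FP]; first by apply/asboolP/FP; rewrite mem_enum.
by apply/allP => j _; apply/asboolP.
Qed.

End Satisfies.

(** [lef] expresses the order by a formula, uniformly in the structure. *)
Section ConditionSentences.
Variables (L : signature) (I : finType) (ar : I -> nat).
Notation E := (ext_sig L ar).
Variables (le : order_of L) (lef : forall n, term E n -> term E n -> qfree E n).
Hypothesis lefP : forall A (M : structure E A) n (v : 'I_n -> A) s t,
  qholds M v (lef s t) <-> le (reduct M) (teval M v s) (teval M v t).

Definition op_term (o : I) n (ts : 'I_(ar o) -> term E n) : term E n :=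
  @App E n (inr o) ts.

Section Operation.
Variable o : I.
Let K n (t : term E n) : term E n := @op_term o _ (fun=> t).
Let x1 : term E 1 := Var E ord0.
Let x2 : term E 2 := Var E ord0.
Let y2 : term E 2 := Var E ord_max.

Definition extensive_sentence : usentence E := Forall (lef x1 (K x1)).
Definition contractive_sentence : usentence E := Forall (lef (K x1) x1).
Definition idem_sentence : usentence E := Forall (QEq (K (K x1)) (K x1)).
Definition involutive_sentence : usentence E := Forall (QEq (K (K x1)) x1).
Definition isotone_sentence : usentence E :=
  Forall (QImp (lef x2 y2) (lef (K x2) (K y2))).
Definition antitone_sentence : usentence E :=
  Forall (QImp (lef x2 y2) (lef (K y2) (K x2))).

Let tuple_term : term E (ar o).+1 := @op_term o _ (fun l => Var E (lift ord0 l)).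
Let replaced_term (k : 'I_(ar o)) : term E (ar o).+1 :=
  @op_term o _ (fun l => if l == k then Var E ord0 else Var E (lift ord0 l)).

(** Variable [0] is the new value of argument [k], and variable [l + 1] is
    argument [l]. *)
Definition isotone_at (k : 'I_(ar o)) : usentence E :=
  Forall (QImp (lef (Var E (lift ord0 k)) (Var E ord0))
               (lef tuple_term (replaced_term k))).
Definition antitone_at (k : 'I_(ar o)) : usentence E :=
  Forall (QImp (lef (Var E (lift ord0 k)) (Var E ord0))
               (lef (replaced_term k) tuple_term)).
Definition above_at (k : 'I_(ar o)) : usentence E :=
  Forall (lef (Var E k) (@op_term o _ (@Var E (ar o)))).

Definition isotone_antitone_sentences i j : seq (usentence E) :=
  [seq isotone_at k | k : 'I_(ar o) <- enum 'I_(ar o) & k < i] ++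
  [seq antitone_at k | k : 'I_(ar o) <- enum 'I_(ar o) & ar o - j <= k].

Definition condition_sentences (c : condition) : seq (usentence E) :=
  match c with
  | A1e => [:: extensive_sentence]
  | A1c => [:: contractive_sentence]
  | A2 => [:: idem_sentence]
  | A2e => [:: idem_sentence; extensive_sentence]
  | A2c => [:: idem_sentence; contractive_sentence]
  | A3 => [:: involutive_sentence]
  | B1 => [:: isotone_sentence]
  | B1e => [:: isotone_sentence; extensive_sentence]
  | B1c => [:: isotone_sentence; contractive_sentence]
  | B2 => [:: isotone_sentence; idem_sentence]
  | B3 => [:: isotone_sentence; extensive_sentence; idem_sentence]
  | B4 => [:: isotone_sentence; contractive_sentence; idem_sentence]
  | B5 => [:: antitone_sentence]
  | C1 i j => isotone_antitone_sentences i j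
  | C2 i j h => isotone_antitone_sentences i j ++
      [seq above_at k | k : 'I_(ar o) <- enum 'I_(ar o) & k < h]
  end.

Variables (A : Type) (M : structure E A).
Let leM := @le A (reduct M).
Let F : ('I_(ar o) -> A) -> A := @new_op _ _ _ A M o.
Let KM (x : A) : A := F (fun=> x).

Lemma extensive_sentenceP : holds M extensive_sentence <-> extensive leM KM.
Proof.
split=> [H x | H v]; last by apply/lefP; apply: H.
by have /lefP := H (fun=> x).
Qed.

Lemma contractive_sentenceP : holds M contractive_sentence <-> contractive leM KM.
Proof.
split=> [H x | H v]; last by apply/lefP; apply: H.
by have /lefP := H (fun=> x).
Qed.

Lemma idem_sentenceP : holds M idem_sentence <-> idem KM.
Proof. by split=> [H x | H v]; [apply: (H (fun=> x)) | apply: H]. Qed.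

Lemma involutive_sentenceP : holds M involutive_sentence <-> involutive KM.
Proof. by split=> [H x | H v]; [apply: (H (fun=> x)) | apply: H]. Qed.

Lemma isotone_sentenceP : holds M isotone_sentence <-> isotone leM KM.
Proof.
split=> [H x y xy | H v /= /lefP xy]; last by apply/lefP; apply: H.
by have /= /(_ _)/lefP := H (args2 x y); apply; apply/lefP.
Qed.

Lemma antitone_sentenceP : holds M antitone_sentence <-> antitone leM KM.
Proof.
split=> [H x y xy | H v /= /lefP xy]; last by apply/lefP; apply: H.
by have /= /(_ _)/lefP := H (args2 x y); apply; apply/lefP.
Qed.

Definition vcons n (z : A) (x : 'I_n -> A) : 'I_n.+1 -> A :=
  fun i => if unlift ord0 i is Some l then x l else z.

Lemma vcons0 n z (x : 'I_n -> A) : vcons z x ord0 = z.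
Proof. by rewrite /vcons unlift_none. Qed.

Lemma vcons_lift n z (x : 'I_n -> A) l : vcons z x (lift ord0 l) = x l.
Proof. by rewrite /vcons liftK. Qed.

Lemma teval_tuple v : teval M v tuple_term = F (fun l => v (lift ord0 l)).
Proof. by []. Qed.

Lemma teval_replaced v k :
  teval M v (replaced_term k) =
  F (fun l => if l == k then v ord0 else v (lift ord0 l)).
Proof.
by rewrite /=; congr (fint M _ _); apply: funext => l; case: ifP.
Qed.

Lemma isotone_atP k : holds M (isotone_at k) <->
  forall x y, differ_only_at k x y -> leM (x k) (y k) -> leM (F x) (F y).
Proof.
split=> [H x y xy xyk | H v /lefP vk]; last first.
  apply/lefP; rewrite teval_replaced teval_tuple; apply: H => [l /negPf->//|].
  by rewrite eqxx.
have /= := H (vcons (y k) x); rewrite !lefP teval_replaced teval_tuple /=.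
rewrite vcons0 vcons_lift => /(_ xyk).
congr (leM (F _) (F _)); apply: funext => l; rewrite vcons_lift //.
by have [->//|/xy] := eqVneq l k.
Qed.

Lemma antitone_atP k : holds M (antitone_at k) <->
  forall x y, differ_only_at k x y -> leM (x k) (y k) -> leM (F y) (F x).
Proof.
split=> [H x y xy xyk | H v /lefP vk]; last first.
  apply/lefP; rewrite teval_replaced teval_tuple; apply: H => [l /negPf->//|].
  by rewrite eqxx.
have /= := H (vcons (y k) x); rewrite !lefP teval_replaced teval_tuple /=.
rewrite vcons0 vcons_lift => /(_ xyk).
congr (leM (F _) (F _)); apply: funext => l; rewrite vcons_lift //.
by have [->//|/xy] := eqVneq l k.
Qed.

Lemma isotone_antitone_sentencesP i j :
  satisfies M (isotone_antitone_sentences i j) <-> isotone_antitone leM i j F.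
Proof.
rewrite satisfies_cat !satisfies_map; split=> -[Hi Hj]; split=> k.
- by move=> x y /Hi/isotone_atP; apply.
- by move=> x y /Hj/antitone_atP; apply.
- by move=> ki; apply/isotone_atP => x y; apply: Hi.
- by move=> kj; apply/antitone_atP => x y; apply: Hj.
Qed.

Lemma condition_sentencesP c :
  satisfies M (condition_sentences c) <-> cond_holds leM c F.
Proof.
case: c => [||||||||||||| i j | i j h] /=.
- by rewrite satisfies1 extensive_sentenceP.
- by rewrite satisfies1 contractive_sentenceP.
- by rewrite satisfies1 idem_sentenceP.
- by rewrite satisfies_cons satisfies1 idem_sentenceP extensive_sentenceP.
- by rewrite satisfies_cons satisfies1 idem_sentenceP contractive_sentenceP.
- by rewrite satisfies1 involutive_sentenceP.
- by rewrite satisfies1 isotone_sentenceP.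
- by rewrite satisfies_cons satisfies1 isotone_sentenceP extensive_sentenceP.
- by rewrite satisfies_cons satisfies1 isotone_sentenceP contractive_sentenceP.
- by rewrite satisfies_cons satisfies1 isotone_sentenceP idem_sentenceP.
- rewrite 2!satisfies_cons satisfies1 isotone_sentenceP idem_sentenceP extensive_sentenceP.
  by split=> [[? []]|[]].
- rewrite 2!satisfies_cons satisfies1 isotone_sentenceP idem_sentenceP contractive_sentenceP.
  by split=> [[? []]|[]].
- by rewrite satisfies1 antitone_sentenceP.
- exact: isotone_antitone_sentencesP.
- rewrite satisfies_cat isotone_antitone_sentencesP satisfies_map.
  split=> -[HF H]; split=> // k.
    by move=> x /H /(_ x)/lefP.
  by move=> kh v; apply/lefP; apply: H.
Qed.

Variables (jnt mtt : forall n, term E n -> term E n -> term E n).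

Fixpoint lterm_term n (t : lterm n) : term E n :=
  match t with
  | LVar k => Var E k
  | LJoin s u => jnt (lterm_term s) (lterm_term u)
  | LMeet s u => mtt (lterm_term s) (lterm_term u)
  end.

Definition lcondition_sentences (c : lcondition (ar o)) : seq (usentence E) :=
  match c with
  | LCond c => condition_sentences c
  | C3 i j t => isotone_antitone_sentences i j ++
      [:: Forall (lef (lterm_term t) (@op_term o _ (@Var E (ar o))))]
  end.

Variables (jn mt : A -> A -> A).
Hypothesis jntP : forall n (v : 'I_n -> A) s t,
  teval M v (jnt s t) = jn (teval M v s) (teval M v t).
Hypothesis mttP : forall n (v : 'I_n -> A) s t,
  teval M v (mtt s t) = mt (teval M v s) (teval M v t).

Lemma teval_lterm n (v : 'I_n -> A) t :
  teval M v (lterm_term t) = lterm_eval jn mt v t.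
Proof. by elim: t => //= s <- u <-. Qed.

Lemma lcondition_sentencesP c :
  satisfies M (lcondition_sentences c) <-> lcond_holds leM jn mt c F.
Proof.
case: c => [c | i j t]; first exact: condition_sentencesP.
rewrite satisfies_cat satisfies1 isotone_antitone_sentencesP /=.
by split=> -[HF H]; split=> // x; [have /lefP := H x | apply/lefP];
  rewrite teval_lterm //; apply: H.
Qed.

End Operation.
End ConditionSentences.

(** * Finite models and decidability *)

Lemma Forall_nth (A : Type) (x0 : A) (X : A -> Prop) s :
  (forall i, i < size s -> X (nth x0 s i)) -> List.Forall X s.
Proof.
elim: s => [|x s IH] Xs; first exact: List.Forall_nil.
by apply: List.Forall_cons; [apply: (Xs 0) | apply: IH => i; apply: (Xs i.+1)].
Qed.

(** The results of the operations are only compared when they stay in [X]; with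
    [X] the whole type this is an embedding of structures. *)
Definition partial_embedding (L : signature) (A C : Type) (M : structure L A)
    (N : structure L C) (X : A -> Prop) (iota : A -> C) : Prop :=
  [/\ forall x y, X x -> X y -> iota x = iota y -> x = y,
      forall f (a : 'I_(farity f) -> A), (forall i, X (a i)) -> X (fint M f a) ->
        fint N f (fun i => iota (a i)) = iota (fint M f a)
    & forall r (a : 'I_(rarity r) -> A), (forall i, X (a i)) ->
        rint N r (fun i => iota (a i)) = rint M r a].

Section Values.
Variables (L : signature) (A : Type) (M : structure L A).

(** The values of all subterms: the part of a structure on which the truth of a
    formula depends. *)
Fixpoint tvalues n (v : 'I_n -> A) (t : term L n) : seq A :=
  teval M v t ::
  match t with
  | Var _ => [::]
  | App f a => flatten [seq tvalues v (a i) | i <- enum 'I_(farity f)]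
  end.

Fixpoint qvalues n (v : 'I_n -> A) (q : qfree L n) : seq A :=
  match q with
  | QEq s t => tvalues v s ++ tvalues v t
  | QRel r a => flatten [seq tvalues v (a i) | i <- enum 'I_(rarity r)]
  | QFalse => [::]
  | QNot p => qvalues v p
  | QAnd p q | QOr p q | QImp p q => qvalues v p ++ qvalues v q
  end.

Lemma nodes_tlist l : sumn (map nodes l) <= nodes (tlist l).
Proof.
by elim: l => //= t l IH; apply: leqW; rewrite leq_add2l.
Qed.

Lemma size_flatten_values (n k : nat) (v : 'I_n -> A) (a : 'I_k -> term L n) :
  (forall i, size (tvalues v (a i)) <= nodes (tcode (a i))) ->
  size (flatten [seq tvalues v (a i) | i <- enum 'I_k]) <=
  nodes (tlist [seq tcode (a i) | i <- enum 'I_k]).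
Proof.
move=> le_a; apply: leq_trans (nodes_tlist _).
rewrite size_flatten /shape -[map size _]map_comp -[map nodes _]map_comp.
by elim: (enum 'I_k) => //= i e IH; apply: leq_add.
Qed.

Lemma nodes_right a b : nodes b < nodes (Node a b).
Proof. by rewrite ltnS leq_addl. Qed.

Lemma size_tvalues n (v : 'I_n -> A) t : size (tvalues v t) <= nodes (tcode t).
Proof.
elim: t => [//|f a IH].
apply: leq_ltn_trans (size_flatten_values IH) _.
exact: ltn_trans (nodes_right _ _) (nodes_right _ _).
Qed.

Lemma size_qvalues n (v : 'I_n -> A) q : size (qvalues v q) <= nodes (qcode q).
Proof.
have pair c s t p r : size s <= nodes p -> size t <= nodes r ->
    @size A (s ++ t) <= nodes (Node c (Node p r)).
  move=> sp tr; rewrite size_cat; apply: leq_trans (leq_add sp tr) _.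
  have lt_pr : nodes p + nodes r < nodes (Node p r) by [].
  exact: ltnW (ltn_trans lt_pr (nodes_right _ _)).
elim: q => [s t|r a||p IHp|p IHp q IHq|p IHp q IHq|p IHp q IHq]; try exact: pair.
- by apply: pair; apply: size_tvalues.
- apply: leq_trans (size_flatten_values (fun i => size_tvalues _ _)) _.
  exact: ltnW (ltn_trans (nodes_right _ _) (nodes_right _ _)).
- by [].
- exact: leq_trans IHp (ltnW (nodes_right _ _)).
Qed.

Lemma Forall_cat (X : A -> Prop) s t :
  List.Forall X (s ++ t) <-> List.Forall X s /\ List.Forall X t.
Proof. exact: List.Forall_app. Qed.

Lemma Forall_flatten (J : finType) (F : J -> seq A) (X : A -> Prop) :
  List.Forall X (flatten [seq F j | j <- enum J]) -> forall j, List.Forall X (F j).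
Proof.
move=> FX j; have : j \in enum J by rewrite mem_enum.
elim: (enum J) FX => //= i e IH /Forall_cat[Fi Fe].
by rewrite inE => /orP[/eqP-> | /IH]; last exact.
Qed.

Variables (C : Type) (N : structure L C) (X : A -> Prop) (iota : A -> C).
Hypothesis emb : partial_embedding M N X iota.

Lemma Forall_teval n (v : 'I_n -> A) t : List.Forall X (tvalues v t) -> X (teval M v t).
Proof. by case: t => [i|f a] H; exact: (List.Forall_inv H). Qed.

Lemma teval_embedding n (v : 'I_n -> A) (t : term L n) :
  List.Forall X (tvalues v t) ->
  teval N (fun i => iota (v i)) t = iota (teval M v t).
Proof.
case: emb => _ embf _.
elim: t => [//|f a IH] /= Xt; rewrite -embf.
- congr (fint N f _); apply: funext => i; apply: IH.
  exact: Forall_flatten (List.Forall_inv_tail Xt) i.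
- move=> i; apply: Forall_teval.
  exact: Forall_flatten (List.Forall_inv_tail Xt) i.
- exact: List.Forall_inv Xt.
Qed.

Lemma qholds_embedding n (v : 'I_n -> A) (q : qfree L n) :
  List.Forall X (qvalues v q) ->
  (qholds N (fun i => iota (v i)) q <-> qholds M v q).
Proof.
case: emb => inj _ embr.
elim: q => [s t|r a||p IHp|p IHp q IHq|p IHp q IHq|p IHp q IHq] //=.
- move=> /Forall_cat[Xs Xt]; rewrite !teval_embedding //.
  by split=> [|->//]; apply: inj; apply: Forall_teval.
- move=> Xa; rewrite -embr => [|i]; last exact: Forall_teval (Forall_flatten Xa i).
  suff -> : (fun i => teval N (fun i => iota (v i)) (a i)) =
            fun i => iota (teval M v (a i)) by [].
  by apply: funext => i; apply: teval_embedding (Forall_flatten Xa i).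
- by move=> /IHp ->.
- by move=> /Forall_cat[/IHp-> /IHq->].
- by move=> /Forall_cat[/IHp-> /IHq->].
- by move=> /Forall_cat[/IHp-> /IHq->].
Qed.
End Values.

Lemma holds_substructure (L : signature) (A B : Type) (M : structure L A)
    (N : structure L B) e s :
  partial_embedding N M (fun=> True) e -> holds M s -> holds N s.
Proof.
move=> emb; case: s => n q /= Mq v.
apply/(qholds_embedding emb) => //.
by apply/List.Forall_forall.
Qed.

Lemma reduct_embedding L (I : finType) (ar : I -> nat) A C
    (M : structure (ext_sig L ar) A) (N : structure (ext_sig L ar) C) X iota :
  partial_embedding M N X iota -> partial_embedding (reduct M) (reduct N) X iota.
Proof. by case=> inj embf embr; split=> // f; apply: (embf (inl f)). Qed.

(** Codes exist for the structures on ordinals only; this brings any finite model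
    into that form. *)
Lemma card_le_ordinal (C : Type) k : inhabited C -> card_le C k ->
  exists n (e : 'I_n.+1 -> C) (g : C -> 'I_n.+1),
    [/\ n < k, cancel e g & cancel g e].
Proof.
move=> [c0] [f f_inj]; pose S := [set i | `[< exists x, f x = i >]].
have fS x : f x \in S by rewrite inE; apply/asboolP; exists x.
have /choice[h hP] i : exists x, i \in S -> f x = i.
  have [|_] := boolP (i \in S); last by exists c0.
  by rewrite inE => /asboolP[x fx]; exists x.
have Sk : #|S| <= k by rewrite -[leqRHS]card_ord max_card.
have S0 : 0 < #|S| by apply/card_gt0P; exists (f c0).
case SE : #|S| => [|n]; first by rewrite SE in S0.
exists n, (fun i => h (enum_val (cast_ord (esym SE) i))).
exists (fun x => cast_ord SE (enum_rank_in (fS c0) (f x))).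
split; first by rewrite -SE.
  by move=> i; rewrite hP ?enum_valP // enum_valK_in cast_ordKV.
by move=> x; apply: f_inj; rewrite cast_ordK enum_rankK_in // hP.
Qed.

Section Transport.
Variables (L : signature) (B C : Type) (N : structure L C) (e : B -> C) (g : C -> B).
Hypotheses (eK : cancel e g) (gK : cancel g e).

Definition transport : structure L B :=
  @Structure L B (fun f a => g (fint N f (fun i => e (a i))))
                 (fun r a => rint N r (fun i => e (a i))).

Lemma transport_embedding : partial_embedding transport N (fun=> True) e.
Proof. by split=> [x y _ _ /(can_inj eK)//|f a _ _ /=|//]; rewrite gK. Qed.

Lemma transport_embedding_inv : partial_embedding N transport (fun=> True) g.
Proof.
split=> [x y _ _ /(can_inj gK)//|f a _ _ /=|r a _ /=]; [congr (g (fint N f _))|congr rint];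
  by apply: funext => i; rewrite gK.
Qed.
End Transport.

(** The class [T] is given by universal sentences, hence it is preserved by the
    transport of a finite model to an ordinal. *)
Theorem finite_model_property_decidable (L : signature) (I : finType)
    (ar : I -> nat) (T0 : utheory L) (S : seq (usentence (ext_sig L ar)))
    (T : class (ext_sig L ar)) (g : nat -> nat) :
  computable g -> finite_models_decidable T0 ->
  (forall A M, T A M <-> models T0 (reduct M) /\ satisfies M S) ->
  (forall (A : Type) (M : structure (ext_sig L ar) A) m (a : 'I_m -> A),
     T A M -> 0 < m -> exists C (N : structure (ext_sig L ar) C) X iota,
     [/\ card_le C (g m), T C N, forall i, X (a i) & partial_embedding M N X iota]) ->
  decidable_universal_consequences T.
Proof.
move=> gC T0dec TE fmp.
apply: (bounded_countermodels_decidable gC).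
  have [p pP] := extension_models_decidable S T0dec.
  by exists p => n M; apply/decidesE; rewrite (propext (TE _ M)); apply/decidesE/pP.
move=> s nTs.
have [A [M [[x0] TM nMs]]] : exists A (M : structure (ext_sig L ar) A),
    [/\ inhabited A, T A M & ~ holds M s].
  apply: contrapT => noM; apply: nTs => A M A0 TM; apply: contrapT => nMs.
  by apply: noM; exists A, M.
set m := nodes (ucode s).
have m0 : 0 < m by rewrite /m; case: (s).
case: s @m m0 nMs {nTs} => n q m m0 /= /existsNP[v nvq].
pose a (i : 'I_m) := nth x0 (qvalues M v q) i.
have [C [N [X [iota [Ck TN Xa emb]]]]] := fmp _ _ m a TM m0.
have nN : ~ holds N (Forall q).
  move=> /(_ (fun i => iota (v i)))/(qholds_embedding emb) H; apply: nvq; apply: H.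
  have szq : size (qvalues M v q) <= m.
    by apply: leq_trans (size_qvalues _ _ _) _; rewrite /m /= leqW // leq_addl.
  apply: (@Forall_nth _ x0) => i lti.
  exact: (Xa (Ordinal (leq_trans lti szq))).
have [k [e [h [ltk eK hK]]]] := card_le_ordinal (inhabits (iota x0)) Ck.
exists k, (transport N e h); split=> //.
  have emb' := transport_embedding N eK hK.
  move: TN => /TE[N0 NS]; apply/TE; split=> [t /N0|].
    exact: holds_substructure (reduct_embedding emb').
  apply: sub_all NS => t /asboolP Nt; apply/asboolP.
  exact: holds_substructure emb' Nt.
move=> Ns; apply: nN.
exact: (holds_substructure (s := Forall q) (transport_embedding_inv N hK) Ns).
Qed.

(** * Locally finite theories of lattices *)

(** The new operations are constructed one at a time, over a fixed reduct. *)
Lemma expand_embedding (L : signature) (I : finType) (ar : I -> nat) (A C : Type)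
    (M : structure (ext_sig L ar) A) (N0 : structure L C) X iota
    (Q : forall o, (('I_(ar o) -> C) -> C) -> Prop) :
  partial_embedding (reduct M) N0 X iota ->
  (forall o, exists2 G, agree X iota (@new_op _ _ _ _ M o) G & Q o G) ->
  exists N : structure (ext_sig L ar) C,
    [/\ partial_embedding M N X iota, reduct N = N0 & forall o, Q o (@new_op _ _ _ _ N o)].
Proof.
case: N0 => f0 r0 [inj embf embr] GP.
pose G o := s2val (cid2 (GP o)).
exists (@Structure (ext_sig L ar) C
  (fun f => match f with inl f => f0 f | inr o => G o end) r0).
split=> //; last by move=> o; apply: s2valP' (cid2 (GP o)).
split=> // -[f | o] b Xb Xf; first exact: embf.
exact: (s2valP (cid2 (GP o))).
Qed.

Lemma teval_args2 (L : signature) (A : Type) (M : structure L A) n (v : 'I_n -> A)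
    k (s t : term L n) (i : 'I_k) :
  teval M v (args2 s t i) = args2 (teval M v s) (teval M v t) i.
Proof. by rewrite /args2; case: ifP. Qed.

Definition term2 (L : signature) (f : fun_sym L) n (s t : term L n) : term L n :=
  App (@args2 _ (farity f) s t).

Lemma teval_term2 (L : signature) (A : Type) (M : structure L A) f n
    (v : 'I_n -> A) s t :
  teval M v (term2 f s t) = fint2 M f (teval M v s) (teval M v t).
Proof.
rewrite /fint2 /=; congr (fint M f _).
by apply: funext => i; apply: teval_args2.
Qed.

Lemma fint2_embedding (L : signature) (A C : Type) (M : structure L A)
    (N : structure L C) X iota f x y :
  partial_embedding M N X iota -> X x -> X y -> X (fint2 M f x y) ->
  fint2 N f (iota x) (iota y) = iota (fint2 M f x y).
Proof.
move=> [_ embf _] Xx Xy Xf; rewrite /fint2 -embf //; last first.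
  by move=> i; rewrite /args2; case: ifP.
by congr (fint N f _); apply: funext => i; rewrite /args2; case: ifP.
Qed.

Section Lattice.
Variables (A : Type) (jn mt : A -> A -> A).
Hypothesis lat : is_lattice jn mt.
Let le x y := mt x y = x.

Let jnC : commutative jn. Proof. by case: lat. Qed.
Let jnA : associative jn. Proof. by case: lat. Qed.
Let mtC : commutative mt. Proof. by case: lat. Qed.
Let mtA : associative mt. Proof. by case: lat. Qed.
Let jnK x y : jn x (mt x y) = x. Proof. by case: lat => _ _ _ _ []. Qed.
Let mtK x y : mt x (jn x y) = x. Proof. by case: lat => _ _ _ _ []. Qed.

Lemma meet_idem x : mt x x = x.
Proof. by rewrite -[X in mt _ X](jnK x x) mtK. Qed.

Lemma lattice_order : partial_order le.
Proof.
split=> [x | x y xy yx | y x z xy yz].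
- exact: meet_idem.
- by rewrite -xy mtC.
- by rewrite /le -xy -mtA yz.
Qed.

Lemma meet_lb x y : le (mt x y) x /\ le (mt x y) y.
Proof.
by split; rewrite /le; [rewrite mtC mtA meet_idem | rewrite -mtA meet_idem].
Qed.

Lemma meet_glb x y z : le z x -> le z y -> le z (mt x y).
Proof. by move=> zx zy; rewrite /le mtA zx. Qed.

Lemma join_ub x y : le x (jn x y) /\ le y (jn x y).
Proof. by split; rewrite /le; [|rewrite jnC]; rewrite mtK. Qed.

Lemma join_lub x y z : le x z -> le y z -> le (jn x y) z.
Proof.
move=> xz yz.
have join_eq u w : le u w -> jn u w = w by move=> <-; rewrite jnC mtC jnK.
have e : jn (jn x y) z = z by rewrite -jnA !join_eq.
by rewrite /le -[X in mt _ X]e mtK.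
Qed.

Lemma meet_mono x y z t : le x z -> le y t -> le (mt x y) (mt z t).
Proof.
have [_ _ trans] := lattice_order; have [h1 h2] := meet_lb x y.
by move=> xz yt; apply: meet_glb; [apply: trans xz | apply: trans yt].
Qed.

Lemma join_mono x y z t : le x z -> le y t -> le (jn x y) (jn z t).
Proof.
have [_ _ trans] := lattice_order; have [h1 h2] := join_ub z t.
by move=> xz yt; apply: join_lub; [apply: trans h1 | apply: trans h2].
Qed.

(** Bounds are accumulated along an injective numbering of the elements; the
    supremum of the empty set is the least element, which is obtained first. *)
Lemma finite_lattice_complete : inhabited A -> finite_type A -> complete le.
Proof.
have [lexx _ trans] := lattice_order.
move=> [x0] [k [f f_inj]] S.
have [b bP] : exists b, forall x, le b x.
  suff /(_ k)[b bP] : forall p, exists b, forall x, f x < p -> le b x.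
    by exists b => x; apply: bP.
  elim=> [|p [b bP]]; first by exists x0.
  have [[y fy]|nop] := EM (exists y, f y = p :> nat); last first.
    exists b => x; rewrite ltnS leq_eqVlt => /orP[/eqP fx|/bP //].
    by case: nop; exists x.
  exists (mt y b) => x; rewrite ltnS leq_eqVlt => /orP[/eqP fx|/bP bx].
    have -> : x = y by apply: f_inj; apply: val_inj; rewrite /= fx fy.
    by case: (meet_lb y b).
  by apply: trans bx; case: (meet_lb y b).
suff /(_ k)[u [ub lub]] : forall p, exists u,
    (forall x, S x -> f x < p -> le x u) /\
    forall y, (forall x, S x -> le x y) -> le u y.
  by exists u; split=> // x Sx; apply: ub.
elim=> [|p [u [ub lub]]]; first by exists b.
have [[y [Sy fy]]|nop] := EM (exists y, S y /\ f y = p :> nat); last first.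
  exists u; split=> // x Sx; rewrite ltnS leq_eqVlt => /orP[/eqP fx|/ub]; last exact.
  by case: nop; exists x.
have [yu uu] := join_ub y u.
exists (jn y u); split=> [x Sx|z zS]; last by apply: join_lub; [apply: zS | apply: lub].
rewrite ltnS leq_eqVlt => /orP[/eqP fx|fx]; last by apply: trans uu; apply: ub.
by have -> : x = y by apply: f_inj; apply: val_inj; rewrite /= fx fy.
Qed.

End Lattice.

Section GeneratedSubstructure.
Variables (L : signature) (A : Type) (M : structure L A) (m : nat) (a : 'I_m -> A).

Definition in_generated (x : A) : Prop := exists t : term L m, teval M a t = x.

Lemma in_generated_fint f (b : 'I_(farity f) -> A) :
  (forall i, in_generated (b i)) -> in_generated (fint M f b).
Proof.
move=> /choice[t tb]; exists (App t) => /=.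
by congr (fint M f _); apply: funext.
Qed.

Definition generated : Type := {x : A | in_generated x}.

Definition generated_structure : structure L generated :=
  @Structure L generated
    (fun f b => exist _ (fint M f (fun i => sval (b i)))
                        (in_generated_fint (fun i => svalP (b i))))
    (fun r b => rint M r (fun i => sval (b i))).

Lemma sval_inj (x y : generated) : sval x = sval y -> x = y.
Proof. by case: x y => [x gx] [y gy] /= e; subst y; congr exist; apply: Prop_irrelevance. Qed.

Lemma generated_embedding :
  partial_embedding generated_structure M (fun=> True) (fun x => sval x).
Proof. by split=> // x y _ _; apply: sval_inj. Qed.

Definition generator (i : 'I_m) : generated :=
  exist _ (a i) (ex_intro (fun t => teval M a t = a i) (Var L i) erefl).

Lemma generated_by_generators : generated_by generated_structure generator.
Proof.
move=> [x [t tx]]; exists t; apply: sval_inj.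
have := teval_embedding generated_embedding (v := generator) (t := t).
by move=> /(_ _) <-; [exact: tx | apply/List.Forall_forall].
Qed.

(** The total function on [A] that inverts the inclusion, with the default value
    [x0] outside the generated part. *)
Definition to_generated (x0 : generated) (x : A) : generated :=
  if pselect (in_generated x) is left p then exist _ x p else x0.

Lemma to_generatedK x0 x : in_generated x -> sval (to_generated x0 x) = x.
Proof. by rewrite /to_generated; case: pselect. Qed.

Lemma to_generated_embedding x0 :
  partial_embedding M generated_structure in_generated (to_generated x0).
Proof.
split=> [x y gx gy e | f b gb gf | r b gb].
- by rewrite -(to_generatedK x0 gx) e to_generatedK.
- apply: sval_inj; rewrite to_generatedK //=; congr (fint M f _).
  by apply: funext => i; apply: to_generatedK.
- rewrite /=; congr rint; apply: funext => i; exact: to_generatedK.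
Qed.
End GeneratedSubstructure.

Definition lattice_sentences (L : signature) (I : finType) (ar : I -> nat)
    (jn mt : fun_sym L) (c : forall o : I, lcondition (ar o)) :
    seq (usentence (ext_sig L ar)) :=
  let jnt n := @term2 (ext_sig L ar) (inl jn) n in
  let mtt n := @term2 (ext_sig L ar) (inl mt) n in
  flatten [seq lcondition_sentences (fun n s t => QEq (mtt n s t) s) jnt mtt (c o)
          | o <- enum I].

Lemma lattice_sentencesP (L : signature) (I : finType) (ar : I -> nat)
    (jn mt : fun_sym L) (c : forall o : I, lcondition (ar o)) A
    (M : structure (ext_sig L ar) A) :
  satisfies M (lattice_sentences jn mt c) <->
  forall o, lcond_holds (le_of_meet mt (reduct M)) (fint2 (reduct M) jn)
     (fint2 (reduct M) mt) (c o) (@new_op _ _ _ _ M o).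
Proof.
rewrite /lattice_sentences satisfies_flatten.
suff H o : satisfies M (lcondition_sentences
    (fun n s t => QEq (@term2 (ext_sig L ar) (inl mt) n s t) s)
    (fun n => @term2 (ext_sig L ar) (inl jn) n)
    (fun n => @term2 (ext_sig L ar) (inl mt) n) (c o)) <->
    lcond_holds (le_of_meet mt (reduct M)) (fint2 (reduct M) jn)
     (fint2 (reduct M) mt) (c o) (@new_op _ _ _ _ M o).
  by split=> HM o; apply/H.
apply: (@lcondition_sentencesP L I ar (le_of_meet mt)).
- move=> B N n v s t.
  have e := teval_term2 N (inl mt) v s t.
  by split=> H; [apply: etrans (esym e) H | apply: etrans e H].
- by move=> n v s t; apply: teval_term2.
- by move=> n v s t; apply: teval_term2.
Qed.

(** The generated substructure is closed under the old operations, as the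
    condition [C3] requires: the values of its lattice term must be represented
    in the finite model. *)
Theorem lattice_extension_decidable (L : signature) (jn mt : fun_sym L)
    (T0 : utheory L) (g : nat -> nat) :
  theory_of_lattices T0 jn mt -> finite_models_decidable T0 ->
  computable g -> generation_bound T0 g ->
  forall (I : finType) (ar : I -> nat) (c : forall o : I, lcondition (ar o)),
  (forall o : I, lcond_wf (c o)) ->
  decidable_universal_consequences (lattice_extension (models T0) jn mt c).
Proof.
move=> [_ _ T0lat] T0dec gC gB I ar c wf_c.
apply: (finite_model_property_decidable (S := lattice_sentences jn mt c) gC T0dec).
  by move=> A M; rewrite /lattice_extension lattice_sentencesP.
move=> A M m a [T0M cM] m0.
pose B := generated (reduct M) a; pose N0 := generated_structure (reduct M) a.
pose x0 : B := generator (reduct M) a (Ordinal m0).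
pose X := in_generated (reduct M) a; pose iota := to_generated x0.
have emb0 : partial_embedding (reduct M) N0 X iota by apply: to_generated_embedding.
have T0N0 : models T0 N0.
  by move=> s /T0M; apply: holds_substructure (generated_embedding _ _).
have latA := T0lat _ _ (inhabits (sval x0)) T0M.
have latB := T0lat _ _ (inhabits x0) T0N0.
have Bg : card_le B (g m).
  exact: (gB _ _ (inhabits x0) T0N0 _ _ (@generated_by_generators _ _ _ _ _)).
have X2 f x y : X x -> X y -> X (fint2 (reduct M) f x y).
  by move=> Xx Xy; apply: in_generated_fint => i; rewrite /args2; case: ifP.
have iota2 f x y : X x -> X y -> X (fint2 (reduct M) f x y) /\
    iota (fint2 (reduct M) f x y) = fint2 N0 f (iota x) (iota y).
  by move=> Xx Xy; split; [|rewrite (fint2_embedding emb0)]; try exact: X2.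
have [|N [emb NN0 cN]] := @expand_embedding _ _ _ _ _ M N0 X iota
    (fun o => lcond_holds (le_of_meet mt N0) (fint2 N0 jn) (fint2 N0 mt) (c o)) emb0.
  move=> o; apply: (extend_lcondition (leA := le_of_meet mt (reduct M))) (wf_c o) (cM o).
  - exact: lattice_order latA.
  - exact: lattice_order latB.
  - by apply: (finite_lattice_complete latB (inhabits x0)); exists (g m).
  - move=> x y Xx Xy; rewrite /le_of_meet.
    have [_ <-] := iota2 mt x y Xx Xy; split=> [->//|]; case: emb0 => inj _ _.
    by apply: inj => //; apply: X2.
  - exact: join_mono latB.
  - exact: meet_mono latB.
  - exact: iota2.
  - exact: iota2.
exists B, N, X, iota; split=> //.
  by split; rewrite NN0.
by move=> i; exists (Var L i).
Qed.

(** * Posets and semilattices *)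

Definition axiomatized (L : signature) (S : seq (usentence L)) : utheory L :=
  fun s => List.In s S.

Lemma models_axiomatized (L : signature) (S : seq (usentence L)) A
    (M : structure L A) :
  models (axiomatized S) M <-> satisfies M S.
Proof.
elim: S => [|s S IH]; first by split=> // _ s [].
rewrite satisfies_cons -IH; split=> [H | [Ms MS] t [<-//|/MS //]].
by split=> [|t tS]; apply: H; [left | right].
Qed.

Lemma axiomatized_decidable (L : signature) (S : seq (usentence L)) :
  finite_models_decidable (axiomatized S).
Proof.
have [p pP] : computed (fun x => tall (fun u => tholds x u) (tlist (map (@ucode _) S))).
  by comp.
exists p => n M; apply/decidesE.
suff -> : num `[< models (axiomatized S) M >] =
    tall (fun u => tholds (scode M) u) (tlist (map (@ucode _) S)) by [].
rewrite (propext (models_axiomatized S M)) tall_tlist all_map /satisfies asboolb.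
congr (num (nat_of_bool _)); apply: eq_all => s /=.
by rewrite tholds_ucode; case: `[< _ >]; [symmetry; apply/eqP|rewrite eqxx].
Qed.

Lemma computable_of (f : tree -> tree) (g : nat -> nat) :
  computed f -> (forall n, f (num n) = num (g n)) -> computable g.
Proof. by move=> [p pP] fg; exists p => n; rewrite -fg. Qed.

Lemma computable_exp2 : computable (fun m => 2 ^ m).
Proof.
apply: (@computable_of (fun x => texp (num 2) x)); first by comp.
by move=> n; rewrite texp_num.
Qed.

Lemma card_le_finType (T : finType) k : #|T| <= k -> card_le T k.
Proof.
move=> Tk; exists (fun x => widen_ord Tk (enum_rank x)) => x y e.
by apply: enum_rank_inj; apply: val_inj; case: e.
Qed.

Section Powerset.
Variable m : nat.
Let C : finType := {set 'I_m}.

Definition subset_le (x y : C) : Prop := x \subset y.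

Lemma subset_order : partial_order subset_le.
Proof.
split=> [x | x y xy yx | y x z]; first exact: subxx.
  by apply/eqP; rewrite eqEsubset; apply/andP.
exact: subset_trans.
Qed.

Lemma subset_complete : complete subset_le.
Proof.
move=> S; exists [set i | `[< exists2 x, S x & i \in x >]]; split=> [x Sx|y Sy].
  by apply/subsetP => i ix; rewrite inE; apply/asboolP; exists x.
apply/subsetP => i; rewrite inE => /asboolP[x Sx ix].
exact: (subsetP (Sy x Sx)).
Qed.

Lemma card_le_powerset : card_le C (2 ^ m).
Proof.
have := card_powerset [set: 'I_m]; rewrite cardsT card_ord => <-.
apply: card_le_finType; rewrite -cardsT; apply: subset_leq_card.
by apply/subsetP => x _; rewrite powersetE subsetT.
Qed.
End Powerset.

(** [T_powerset] says that finitely many elements [a_i] embed into a structure of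
    the class on the power set of their indices, whose order is inclusion.  All
    complete-lattice constructions are then available, whatever the language. *)
Section OrderedExtension.
Variables (L : signature) (le : order_of L).
Variable (lef : forall (I : finType) (ar : I -> nat) n,
  term (ext_sig L ar) n -> term (ext_sig L ar) n -> qfree (ext_sig L ar) n).
Hypothesis lefP : forall (I : finType) (ar : I -> nat) A
    (M : structure (ext_sig L ar) A) n (v : 'I_n -> A) s t,
  qholds M v (lef s t) <-> le (reduct M) (teval M v s) (teval M v t).
Variables (T : class L) (S : seq (usentence L)).
Hypothesis TE : forall A (M : structure L A), T M <-> satisfies M S.
Hypothesis T_order : forall A (M : structure L A), T M -> partial_order (le M).
Hypothesis T_powerset : forall A (M : structure L A) m (a : 'I_m -> A), T M ->
  exists (N : structure L {set 'I_m}) (iota : A -> {set 'I_m}),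
  [/\ T N, forall x y, le N x y <-> x \subset y,
      forall i j, le M (a i) (a j) <-> iota (a i) \subset iota (a j),
      forall f b, fint N f (fun k => iota (b k)) = iota (fint M f b)
    & forall r b, (forall k, exists i, b k = a i) ->
        rint N r (fun k => iota (b k)) = rint M r b].

Theorem ordered_extension_decidable (I : finType) (ar : I -> nat)
    (c : I -> condition) : (forall o : I, cond_wf (ar o) (c o)) ->
  decidable_universal_consequences (@ordered_extension L I ar T le c).
Proof.
move=> wf_c.
pose Sc := flatten [seq @condition_sentences L I ar (@lef I ar) o (c o) | o <- enum I].
apply: (finite_model_property_decidable (T0 := axiomatized S) (S := Sc)
  computable_exp2 (@axiomatized_decidable _ _)).
  move=> A M; rewrite /ordered_extension models_axiomatized -TE satisfies_flatten.
  by split=> -[TM cM]; split=> // o; apply/(condition_sentencesP (@lefP I ar)).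
move=> A M m a [TM cM] m0.
have [N0 [iota [TN leN le_iota embf embr]]] := T_powerset a TM.
pose X x := exists i, x = a i.
have poA := T_order TM.
have leNE : le N0 = @subset_le m.
  by apply: funext => x; apply: funext => y; apply: propext; apply: leN.
have le_emb x y : X x -> X y -> (le (reduct M) x y <-> subset_le (iota x) (iota y)).
  by move=> [i ->] [j ->]; apply: le_iota.
have emb0 : partial_embedding (reduct M) N0 X iota.
  split=> [x y Xx Xy e|f b _ _|r b Xb]; [|exact: embf|exact: embr].
  case: poA => _ anti _.
  by apply: anti; apply/le_emb => //; rewrite e; apply: subxx.
have [|N [emb NN0 cN]] := @expand_embedding _ _ _ _ _ M N0 X iota
    (fun o => cond_holds (le N0) (c o)) emb0.
  move=> o; rewrite leNE.
  exact: (extend_condition poA (@subset_order m) (@subset_complete m) le_emb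
    (wf_c o) (cM o)).
exists {set 'I_m}, N, X, iota; split=> //.
- exact: card_le_powerset.
- by split; rewrite NN0.
- by move=> i; exists i.
Qed.
End OrderedExtension.

Lemma args2_eta A (b : 'I_2 -> A) : b = args2 (b ord0) (b ord_max).
Proof.
apply: funext => i; rewrite /args2; case: eqP => i0; congr (b _); apply: val_inj => //=.
by case: i i0 => -[|[|]].
Qed.

Lemma po_le_unique (r : rel_sym poset_sig) : r = po_le.
Proof. by case: r => -[|//] i; apply: val_inj. Qed.

Lemma sl_op_unique (f : fun_sym semilattice_sig) : f = sl_op.
Proof. by case: f => -[|//] i; apply: val_inj. Qed.

Definition v3 A (x y z : A) : 'I_3 -> A := fun i => nth x [:: x; y; z] i.

Section SmallSentences.
Variables (L : signature).
Definition t1 : term L 1 := Var L ord0.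
Definition t2x : term L 2 := Var L ord0.
Definition t2y : term L 2 := Var L ord_max.
Definition t3x : term L 3 := Var L (@Ordinal 3 0 isT).
Definition t3y : term L 3 := Var L (@Ordinal 3 1 isT).
Definition t3z : term L 3 := Var L (@Ordinal 3 2 isT).
End SmallSentences.

Lemma qholds_eq (L : signature) A (M : structure L A) n (v : 'I_n -> A) s t :
  qholds M v (QEq s t) = (teval M v s = teval M v t).
Proof. by []. Qed.

Lemma qholds_and (L : signature) A (M : structure L A) n (v : 'I_n -> A) p q :
  qholds M v (QAnd p q) = (qholds M v p /\ qholds M v q).
Proof. by []. Qed.

Lemma qholds_imp (L : signature) A (M : structure L A) n (v : 'I_n -> A) p q :
  qholds M v (QImp p q) = (qholds M v p -> qholds M v q).
Proof. by []. Qed.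

Section Posets.
Let le n (s t : term poset_sig n) : qfree poset_sig n :=
  QRel (@args2 _ (rarity po_le) s t).

Definition poset_axioms : seq (usentence poset_sig) :=
  [:: Forall (le (t1 _) (t1 _));
      Forall (QImp (QAnd (le (t2x _) (t2y _)) (le (t2y _) (t2x _)))
                   (QEq (t2x _) (t2y _)));
      Forall (QImp (QAnd (le (t3y _) (t3x _)) (le (t3x _) (t3z _)))
                   (le (t3y _) (t3z _)))].

Lemma qholds_poset_le A (M : structure poset_sig A) n (v : 'I_n -> A) s t :
  qholds M v (le s t) = rint2 M po_le (teval M v s) (teval M v t).
Proof.
rewrite /= /rint2; congr (is_true (rint M po_le _)); apply: funext => i.
exact: teval_args2.
Qed.

Lemma poset_axiomsP A (M : structure poset_sig A) :
  posets M <-> satisfies M poset_axioms.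
Proof.
rewrite -[poset_axioms]/([:: _] ++ [:: _] ++ [:: _]) !satisfies_cat !satisfies1.
split=> [[refl anti trans] | [refl [anti trans]]].
  split; first by move=> v; rewrite qholds_poset_le.
  split=> v; rewrite qholds_imp qholds_and ?qholds_eq !qholds_poset_le => -[h1 h2].
    by apply: anti; apply/andP.
  exact: trans h1 h2.
split.
- by move=> x; have := refl (fun=> x); rewrite qholds_poset_le.
- move=> x y /andP[xy yx]; have := anti (args2 x y).
  by rewrite qholds_imp qholds_and ?qholds_eq !qholds_poset_le; apply.
- move=> y x z xy yz; have := trans (v3 y x z).
  by rewrite qholds_imp qholds_and ?qholds_eq !qholds_poset_le; apply.
Qed.

(** The index [i] is missing from [iota (a i)] by reflexivity; so, if [iota x] is
    included in [iota (a i)], then [i] is missing from [iota x], that is,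
    [x <= a i]. *)
Lemma posets_powerset A (M : structure poset_sig A) m (a : 'I_m -> A) : posets M ->
  exists (N : structure poset_sig {set 'I_m}) (iota : A -> {set 'I_m}),
  [/\ posets N, forall x y, le_of_rel po_le N x y <-> x \subset y,
      forall i j, le_of_rel po_le M (a i) (a j) <-> iota (a i) \subset iota (a j),
      forall f b, fint N f (fun k => iota (b k)) = iota (fint M f b)
    & forall r b, (forall k, exists i, b k = a i) ->
        rint N r (fun k => iota (b k)) = rint M r b].
Proof.
move=> [refl anti trans].
pose N : structure poset_sig {set 'I_m} := @Structure poset_sig _
  (fun f _ => set0)
  (fun r b => [forall i : 'I_(rarity r), forall j : 'I_(rarity r),
     (i <= j) ==> (b i \subset b j)]).
pose iota x := [set i | ~~ rint2 M po_le x (a i)].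
have leN x y : rint2 N po_le x y = (x \subset y).
  apply/forallP/idP => [/(_ ord0)/forallP/(_ ord_max) //|xy [i lti]].
  apply/forallP => -[j ltj]; apply/implyP; rewrite /args2 /=.
  by case: i j {lti ltj} => [|i] [|j].
have le_iota x i : rint2 M po_le x (a i) = (iota x \subset iota (a i)).
  apply/idP/subsetP => [xi j|/(_ i)]; rewrite !inE.
    by apply: contra; apply: trans xi.
  by rewrite refl; case: rint2 => // /(_ isT).
exists N, iota; split.
- split=> [x|x y|y x z]; rewrite !leN ?subxx //; last exact: subset_trans.
  by move=> xy; apply/eqP; rewrite eqEsubset.
- by move=> x y; rewrite /le_of_rel leN.
- by move=> i j; rewrite /le_of_rel le_iota.
- by move=> -[].
- move=> r b Xb; have rE := po_le_unique r; subst r.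
  have [i1 bi1] := Xb ord_max.
  have -> : rint M po_le b = rint2 M po_le (b ord0) (b ord_max).
    by rewrite /rint2 [b in LHS]args2_eta.
  rewrite bi1 le_iota -bi1 -leN /rint2; congr (rint N po_le _).
  by rewrite [LHS]args2_eta.
Qed.

Theorem poset_extension_decidable (I : finType) (ar : I -> nat) (c : I -> condition) :
  (forall o : I, cond_wf (ar o) (c o)) ->
  decidable_universal_consequences
    (@ordered_extension _ I ar posets (le_of_rel po_le) c).
Proof.
apply: (@ordered_extension_decidable _ _ (fun I ar n s t =>
   @QRel (ext_sig poset_sig ar) n po_le (args2 s t)) _ _ poset_axioms).
- move=> J aj A M n v s t; rewrite /le_of_rel /rint2 /=.
  suff -> : (fun i => teval M v (args2 s t i)) = args2 (teval M v s) (teval M v t) by [].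
  by move=> k; apply: funext => i; apply: teval_args2.
- exact: poset_axiomsP.
- move=> A M [refl anti trans]; split=> // x y xy yx.
  by apply: anti; apply/andP.
- exact: posets_powerset.
Qed.
End Posets.

Section SemilatticeOrders.
Variables (A : Type) (op : A -> A -> A).
Hypothesis sl : is_semilattice op.
Let opC : commutative op. Proof. by case: sl. Qed.
Let opA : associative op. Proof. by case: sl. Qed.
Let opxx : idempotent_op op. Proof. by case: sl. Qed.

Lemma join_order : partial_order (fun x y => op x y = y).
Proof.
split=> [x|x y xy yx|y x z xy yz]; first exact: opxx.
  by rewrite -yx opC xy.
by rewrite -yz opA xy.
Qed.

Lemma meet_order : partial_order (fun x y => op x y = x).
Proof.
split=> [x|x y xy yx|y x z xy yz]; first exact: opxx.
  by rewrite -xy opC yx.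
by rewrite -xy -opA yz.
Qed.

Lemma join_le x y z : op (op x y) z = z <-> op x z = z /\ op y z = z.
Proof.
split=> [e|[xz yz]]; last by rewrite -opA yz xz.
by split; rewrite -e ?(opA x) ?opA ?opxx // (opC y) -(opA x) opxx.
Qed.

Lemma le_meet x y z : op z (op x y) = z <-> op z x = z /\ op z y = z.
Proof.
split=> [e|[zx zy]]; last by rewrite opA zx zy.
by split; rewrite -e -!opA; [rewrite (opC _ x) (opA x) opxx | rewrite opxx].
Qed.
End SemilatticeOrders.

Section Semilattices.
Let op n (s t : term semilattice_sig n) := term2 sl_op s t.

Definition semilattice_axioms : seq (usentence semilattice_sig) :=
  [:: Forall (QEq (op (t2x _) (t2y _)) (op (t2y _) (t2x _)));
      Forall (QEq (op (t3x _) (op (t3y _) (t3z _))) (op (op (t3x _) (t3y _)) (t3z _)));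
      Forall (QEq (op (t1 _) (t1 _)) (t1 _))].

Lemma semilattice_axiomsP A (M : structure semilattice_sig A) :
  semilattices M <-> satisfies M semilattice_axioms.
Proof.
rewrite -[semilattice_axioms]/([:: _] ++ [:: _] ++ [:: _]) !satisfies_cat !satisfies1.
split=> [[comm assoc idem] | [comm [assoc idem]]].
  split=> [v|]; first by rewrite qholds_eq !teval_term2; apply: comm.
  split=> v; rewrite qholds_eq !teval_term2; first exact: assoc.
  exact: idem.
split.
- by move=> x y; have := comm (args2 x y); rewrite qholds_eq !teval_term2.
- by move=> x y z; have := assoc (v3 x y z); rewrite qholds_eq !teval_term2.
- by move=> x; have := idem (fun=> x); rewrite qholds_eq !teval_term2.
Qed.

Section Powerset.
Variables (A : Type) (M : structure semilattice_sig A) (m : nat) (a : 'I_m -> A).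
Hypothesis slM : semilattices M.

Lemma fint_semilattice (B : Type) (N : structure semilattice_sig B) f (b : 'I_(farity f) -> B) :
  exists k l, fint N f b = fint2 N sl_op (b k) (b l) /\ forall i, i = k \/ i = l.
Proof.
have fE := sl_op_unique f; subst f.
exists ord0, ord_max; split; first by rewrite /fint2 [b in LHS]args2_eta.
by move=> -[[|[|//]] i]; [left | right]; apply: val_inj.
Qed.

(** [x] is sent to the indices [i] with [~ (x <= a i)]: a join is below [a i] if
    and only if both arguments are, so joins become unions. *)
Lemma join_powerset :
  exists (N : structure semilattice_sig {set 'I_m}) (iota : A -> {set 'I_m}),
  [/\ semilattices N, forall x y, le_of_join sl_op N x y <-> x \subset y,
      forall i j, le_of_join sl_op M (a i) (a j) <-> iota (a i) \subset iota (a j),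
      forall f b, fint N f (fun k => iota (b k)) = iota (fint M f b)
    & forall r b, (forall k, exists i, b k = a i) ->
        rint N r (fun k => iota (b k)) = rint M r b].
Proof.
pose N : structure semilattice_sig {set 'I_m} := @Structure semilattice_sig _
  (fun f b => \bigcup_i b i) (fun r _ => true).
pose le x y := fint2 M sl_op x y = y.
pose iota x := [set i | ~~ `[< le x (a i) >]].
have opN x y : fint2 N sl_op x y = x :|: y.
  by rewrite /fint2 /= big_ord_recl big_ord1.
have [le_refl _ le_trans] : partial_order le := join_order slM.
exists N, iota; split.
- split=> [x y|x y z|x]; rewrite !opN; [exact: setUC|exact: setUA|exact: setUid].
- by move=> x y; rewrite /le_of_join opN; split=> /setUidPr.
- move=> k i; split=> [xi|/subsetP/(_ i)].
    apply/subsetP => j; rewrite !inE; apply: contra => /asboolP ij.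
    by apply/asboolP; apply: le_trans xi ij.
  rewrite !inE => H; apply: contrapT => nle.
  by move: H; rewrite asboolF // asboolT; [move=> /(_ isT)|apply: le_refl].
- move=> f b; have [k [l [-> kl]]] := fint_semilattice M b.
  apply/setP => i; rewrite inE; apply/bigcupP/idP => [[j _]|].
    rewrite inE; apply: contra => /asboolP/(join_le slM)[ki li].
    by apply/asboolP; have [->|->] := kl j.
  rewrite -(asbool_neg) => /asboolP nle.
  have [ki|nki] := EM (le (b k) (a i)); last first.
    by exists k => //; rewrite inE; apply/negP => /asboolP.
  exists l => //; rewrite inE; apply/negP => /asboolP li.
  by apply: nle; apply/(join_le slM).
- by move=> -[].
Qed.

(** Dually, [a i] is below a meet if and only if it is below both arguments, so
    sending [x] to the indices [i] with [a i <= x] turns meets into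
    intersections. *)
Lemma meet_powerset :
  exists (N : structure semilattice_sig {set 'I_m}) (iota : A -> {set 'I_m}),
  [/\ semilattices N, forall x y, le_of_meet sl_op N x y <-> x \subset y,
      forall i j, le_of_meet sl_op M (a i) (a j) <-> iota (a i) \subset iota (a j),
      forall f b, fint N f (fun k => iota (b k)) = iota (fint M f b)
    & forall r b, (forall k, exists i, b k = a i) ->
        rint N r (fun k => iota (b k)) = rint M r b].
Proof.
pose N : structure semilattice_sig {set 'I_m} := @Structure semilattice_sig _
  (fun f b => \bigcap_i b i) (fun r _ => true).
pose le x y := fint2 M sl_op x y = x.
pose iota x := [set i | `[< le (a i) x >]].
have opN x y : fint2 N sl_op x y = x :&: y.
  by rewrite /fint2 /= big_ord_recl big_ord1.
have [le_refl _ le_trans] : partial_order le := meet_order slM.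
exists N, iota; split.
- split=> [x y|x y z|x]; rewrite !opN; [exact: setIC|exact: setIA|exact: setIid].
- by move=> x y; rewrite /le_of_meet opN; split=> /setIidPl.
- move=> k i; split=> [ki|/subsetP/(_ k)].
    apply/subsetP => j; rewrite !inE => /asboolP jk.
    by apply/asboolP; apply: le_trans jk ki.
  rewrite !inE asboolT; last exact: le_refl.
  by move=> /(_ isT)/asboolP.
- move=> f b; have [k [l [-> kl]]] := fint_semilattice M b.
  apply/setP => i; rewrite inE; apply/bigcapP/idP => [H|/asboolP/(le_meet slM)[ik il] j _].
    apply/asboolP/(le_meet slM).
    by have := H k isT; have := H l isT; rewrite !inE => /asboolP ? /asboolP.
  by rewrite inE; apply/asboolP; have [->|->] := kl j.
- by move=> -[].
Qed.
End Powerset.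

Theorem join_semilattice_extension_decidable (I : finType) (ar : I -> nat)
    (c : I -> condition) : (forall o : I, cond_wf (ar o) (c o)) ->
  decidable_universal_consequences
    (@ordered_extension _ I ar semilattices (le_of_join sl_op) c).
Proof.
apply: (@ordered_extension_decidable _ _ (fun I ar n s t =>
   QEq (@term2 (ext_sig semilattice_sig ar) (inl sl_op) n s t) t)
   _ _ semilattice_axioms).
- move=> J aj A M n v s t.
  have e := teval_term2 M (inl sl_op) v s t.
  by split=> H; [apply: etrans (esym e) H | apply: etrans e H].
- exact: semilattice_axiomsP.
- by move=> A M; apply: join_order.
- exact: join_powerset.
Qed.

Theorem meet_semilattice_extension_decidable (I : finType) (ar : I -> nat)
    (c : I -> condition) : (forall o : I, cond_wf (ar o) (c o)) ->
  decidable_universal_consequences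
    (@ordered_extension _ I ar semilattices (le_of_meet sl_op) c).
Proof.
apply: (@ordered_extension_decidable _ _ (fun I ar n s t =>
   QEq (@term2 (ext_sig semilattice_sig ar) (inl sl_op) n s t) s)
   _ _ semilattice_axioms).
- move=> J aj A M n v s t.
  have e := teval_term2 M (inl sl_op) v s t.
  by split=> H; [apply: etrans (esym e) H | apply: etrans e H].
- exact: semilattice_axiomsP.
- by move=> A M; apply: meet_order.
- exact: meet_powerset.
Qed.
End Semilattices.

(** * Distributive lattices and Boolean algebras *)

Section DistributiveLattice.
Variables (A : Type) (jn mt : A -> A -> A).
Hypothesis dlat : is_distributive_lattice jn mt.
Let lat : is_lattice jn mt. Proof. by case: dlat. Qed.
Let le x y := mt x y = x.
Let po : partial_order le := lattice_order lat.
Let le_trans y x z : le x y -> le y z -> le x z. Proof. by case: po => _ _; apply. Qed.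
Let le_anti x y : le x y -> le y x -> x = y. Proof. by case: po => _ + _; apply. Qed.
Let mtA : associative mt. Proof. by case: lat. Qed.
Let mtC : commutative mt. Proof. by case: lat. Qed.

Variables (G : finType) (gens : G -> A).

(** A relation rather than an operation, as the empty meet need not exist. *)
Definition meet_of (U : {set G}) (w : A) : Prop :=
  (forall i, i \in U -> le w (gens i)) /\
  (forall y, (forall i, i \in U -> le y (gens i)) -> le y w).

(** That [x] is the join of the meets of generators below it, expressed without
    finite joins.  The element [z] is what makes the property stable under meets:
    it stands for the other factor, through which the meet distributes. *)
Definition join_of_meets (x : A) : Prop := forall y z,
  (forall U w, meet_of U w -> le w x -> le (mt w z) y) -> le (mt x z) y.

Lemma meet_of_unique U w w' : meet_of U w -> meet_of U w' -> w = w'.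
Proof. by move=> [w1 w2] [w1' w2']; apply: le_anti; [apply: w2' | apply: w2]. Qed.

Lemma meet_of_setU U V w w' :
  meet_of U w -> meet_of V w' -> meet_of (U :|: V) (mt w w').
Proof.
have [lb1 lb2] := meet_lb lat w w'.
move=> [w1 w2] [w1' w2']; split=> [i|y yUV].
  rewrite inE => /orP[/w1|/w1']; exact: le_trans.
by apply: (meet_glb lat); [apply: w2 | apply: w2'] => i iU; apply: yUV; rewrite inE iU ?orbT.
Qed.

Lemma join_of_meets_gen i : join_of_meets (gens i).
Proof.
move=> y z H; apply: (H [set i]); last by case: po.
split=> [j /set1P->|u]; first by case: po.
by apply; rewrite set11.
Qed.

Lemma join_of_meets_join x1 x2 :
  join_of_meets x1 -> join_of_meets x2 -> join_of_meets (jn x1 x2).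
Proof.
move=> P1 P2 y z H; have [ub1 ub2] := join_ub lat x1 x2.
case: dlat => _ ->; apply: (join_lub lat).
  by apply: P1 => U w Uw wx; apply: (H U) => //; apply: le_trans ub1.
by apply: P2 => U w Uw wx; apply: (H U) => //; apply: le_trans ub2.
Qed.

(** For a meet [w] below [x1] and a meet [w'] below [x2], the element
    [mt w' w] is a meet of generators below [mt x1 x2]. *)
Lemma join_of_meets_meet x1 x2 :
  join_of_meets x1 -> join_of_meets x2 -> join_of_meets (mt x1 x2).
Proof.
move=> P1 P2 y z H; rewrite -mtA; apply: P1 => U w Uw wx1.
rewrite mtA (mtC w) -mtA; apply: P2 => V w' Vw' w'x2.
rewrite mtA; apply: (H (V :|: U)); first exact: meet_of_setU.
by rewrite mtC; apply: (meet_mono lat).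
Qed.

(** An element is determined by the set of the [U] whose meet lies below it. *)
Lemma card_le_join_of_meets :
  (forall x, join_of_meets x) -> card_le A (2 ^ (2 ^ #|G|)).
Proof.
move=> Pall.
pose F x : {set {set G}} := [set U | `[< exists2 w, meet_of U w & le w x >]].
have F_le x y : F x = F y -> le x y.
  move=> Fxy; have [lexx _ _] := po.
  rewrite /le -[X in mt X y](meet_idem lat x) -[X in _ = X](meet_idem lat x).
  apply: Pall => U w Uw wx.
  have : U \in F x by rewrite inE; apply/asboolP; exists w.
  rewrite Fxy inE => /asboolP[w' Uw' w'y].
  rewrite -(meet_of_unique Uw Uw') in w'y.
  have [wxw _] := meet_lb lat w x; exact: le_trans wxw w'y.
have [f f_inj] : card_le {set {set G}} (2 ^ (2 ^ #|G|)).
  apply: card_le_finType; have := card_powerset [set: {set G}].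
  by rewrite powersetT !cardsT -[#|{set G}| in RHS]cardsT -powersetT card_powerset
    cardsT => ->.
exists (fun x => f (F x)) => x y /f_inj Fxy.
by apply: le_anti; apply: F_le.
Qed.

End DistributiveLattice.

Lemma computable_exp2_comp (g : nat -> nat) (f : tree -> tree) :
  computed f -> (forall n, f (num n) = num (g n)) ->
  computable (fun m => 2 ^ (2 ^ g m)).
Proof.
move=> fC fg.
apply: (@computable_of (fun x => texp (num 2) (texp (num 2) (f x)))); first by comp.
by move=> n; rewrite fg !texp_num.
Qed.

Section Equations.
Variables (L : signature) (A : Type) (M : structure L A).

Lemma equation1P (s t : term L 1) (e e' : A -> A) :
  (forall x, teval M (fun=> x) s = e x) -> (forall x, teval M (fun=> x) t = e' x) ->
  holds M (Forall (QEq s t)) <-> forall x, e x = e' x.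
Proof.
move=> se te; split=> [H x|H v]; first by rewrite -se -te; apply: (H (fun=> x)).
have -> : v = fun=> v ord0 by apply: funext => i; rewrite ord1.
by rewrite qholds_eq se te.
Qed.

Lemma equation2P (s t : term L 2) (e e' : A -> A -> A) :
  (forall x y, teval M (args2 x y) s = e x y) ->
  (forall x y, teval M (args2 x y) t = e' x y) ->
  holds M (Forall (QEq s t)) <-> forall x y, e x y = e' x y.
Proof.
move=> se te; split=> [H x y|H v]; first by rewrite -se -te; apply: (H (args2 x y)).
by rewrite qholds_eq (args2_eta v) se te.
Qed.

Lemma v3_eta (v : 'I_3 -> A) :
  v = v3 (v (@Ordinal 3 0 isT)) (v (@Ordinal 3 1 isT)) (v (@Ordinal 3 2 isT)).
Proof. by apply: funext => -[[|[|[|]]] i] //; congr v; apply: val_inj. Qed.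

Lemma equation3P (s t : term L 3) (e e' : A -> A -> A -> A) :
  (forall x y z, teval M (v3 x y z) s = e x y z) ->
  (forall x y z, teval M (v3 x y z) t = e' x y z) ->
  holds M (Forall (QEq s t)) <-> forall x y z, e x y z = e' x y z.
Proof.
move=> se te; split=> [H x y z|H v]; first by rewrite -se -te; apply: (H (v3 x y z)).
by rewrite qholds_eq (v3_eta v) se te.
Qed.
End Equations.

Section LatticeSentences.
Variables (L : signature) (jn mt : fun_sym L).
Let j n (s t : term L n) := term2 jn s t.
Let k n (s t : term L n) := term2 mt s t.

Definition distributive_lattice_axioms : seq (usentence L) :=
  [:: Forall (QEq (j (t2x _) (t2y _)) (j (t2y _) (t2x _)));
      Forall (QEq (j (t3x _) (j (t3y _) (t3z _))) (j (j (t3x _) (t3y _)) (t3z _)));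
      Forall (QEq (k (t2x _) (t2y _)) (k (t2y _) (t2x _)));
      Forall (QEq (k (t3x _) (k (t3y _) (t3z _))) (k (k (t3x _) (t3y _)) (t3z _)));
      Forall (QEq (j (t2x _) (k (t2x _) (t2y _))) (t2x _));
      Forall (QEq (k (t2x _) (j (t2x _) (t2y _))) (t2x _));
      Forall (QEq (k (j (t3x _) (t3y _)) (t3z _))
                  (j (k (t3x _) (t3z _)) (k (t3y _) (t3z _))))].

Lemma distributive_lattice_axiomsP A (M : structure L A) :
  satisfies M distributive_lattice_axioms <->
  is_distributive_lattice (fint2 M jn) (fint2 M mt).
Proof.
set J := fint2 M jn; set K := fint2 M mt.
have jC : holds M (Forall (QEq (j (t2x _) (t2y _)) (j (t2y _) (t2x _)))) <->
    commutative J by apply: equation2P => x y; rewrite !teval_term2.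
have jA : holds M (Forall (QEq (j (t3x _) (j (t3y _) (t3z _)))
    (j (j (t3x _) (t3y _)) (t3z _)))) <-> associative J.
  by apply: equation3P => x y z; rewrite !teval_term2.
have kC : holds M (Forall (QEq (k (t2x _) (t2y _)) (k (t2y _) (t2x _)))) <->
    commutative K by apply: equation2P => x y; rewrite !teval_term2.
have kA : holds M (Forall (QEq (k (t3x _) (k (t3y _) (t3z _)))
    (k (k (t3x _) (t3y _)) (t3z _)))) <-> associative K.
  by apply: equation3P => x y z; rewrite !teval_term2.
have jK : holds M (Forall (QEq (j (t2x _) (k (t2x _) (t2y _))) (t2x _))) <->
    forall x y, J x (K x y) = x by apply: equation2P => x y; rewrite ?teval_term2.
have kJ : holds M (Forall (QEq (k (t2x _) (j (t2x _) (t2y _))) (t2x _))) <->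
    forall x y, K x (J x y) = x by apply: equation2P => x y; rewrite ?teval_term2.
have kD : holds M (Forall (QEq (k (j (t3x _) (t3y _)) (t3z _))
    (j (k (t3x _) (t3z _)) (k (t3y _) (t3z _))))) <-> left_distributive K J.
  by apply: equation3P => x y z; rewrite !teval_term2.
rewrite /distributive_lattice_axioms 6!satisfies_cons satisfies1.
rewrite jC jA kC kA jK kJ kD.
by split=> [[? [? [? [? [? [? ?]]]]]]|[[? ? ? ? [? ?]] ?]].
Qed.
End LatticeSentences.

Lemma axiomatized_lattices (L : signature) (jn mt : fun_sym L) S :
  farity jn = 2 -> farity mt = 2 ->
  (forall A (M : structure L A), satisfies M S ->
     is_distributive_lattice (fint2 M jn) (fint2 M mt)) ->
  theory_of_lattices (axiomatized S) jn mt.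
Proof. move=> j2 m2 H; split=> // A M _ /models_axiomatized/H[lat _]; exact: lat. Qed.

Lemma decidable_universal_consequences_ext (L : signature) (T T' : class L) :
  (forall A (M : structure L A), T A M <-> T' A M) ->
  decidable_universal_consequences T' -> decidable_universal_consequences T.
Proof.
move=> TT'; suff -> : T = T' by [].
by apply: functional_extensionality_dep => A; apply: funext => M; apply: propext.
Qed.

Lemma lat_sym_cases (f : fun_sym lattice_sig) : f = lat_join \/ f = lat_meet.
Proof. by case: f => -[|[|//]] i; [left | right]; apply: val_inj. Qed.

Lemma distributive_generation_bound :
  generation_bound
    (axiomatized (distributive_lattice_axioms lat_join lat_meet))
    (fun m => 2 ^ (2 ^ m)).
Proof.
move=> A M _ /models_axiomatized/distributive_lattice_axiomsP dlM m a gen.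
rewrite -[m in 2 ^ (2 ^ m)]card_ord.
apply: (card_le_join_of_meets dlM (gens := a)) => x.
have [t <-] := gen x; elim: t => [i|f b IH] /=; first exact: (@join_of_meets_gen _ _ _ dlM _ a i).
have [fE|fE] := lat_sym_cases f; subst f.
  rewrite [fun i => _]args2_eta; exact: (join_of_meets_join dlM (IH _) (IH _)).
rewrite [fun i => _]args2_eta; exact: (join_of_meets_meet dlM (IH _) (IH _)).
Qed.

Theorem distributive_extension_decidable (I : finType) (ar : I -> nat)
    (c : forall o : I, lcondition (ar o)) : (forall o : I, lcond_wf (c o)) ->
  decidable_universal_consequences
    (lattice_extension distributive_lattices lat_join lat_meet c).
Proof.
move=> wf_c.
pose S := distributive_lattice_axioms lat_join lat_meet.
apply: (@decidable_universal_consequences_ext _ _ (lattice_extension (models (axiomatized S)) lat_join lat_meet c)).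
  by move=> A M; rewrite /lattice_extension models_axiomatized distributive_lattice_axiomsP.
apply: lattice_extension_decidable wf_c.
- by apply: axiomatized_lattices => // A M /distributive_lattice_axiomsP.
- exact: axiomatized_decidable.
- by apply: (computable_exp2_comp (f := id)) => //; comp.
- exact: distributive_generation_bound.
Qed.

Section BooleanAlgebra.
Variables (A : Type) (jn mt : A -> A -> A) (cp : A -> A) (bot top : A).
Hypothesis ba : is_boolean_algebra jn mt cp bot top.
Let dlat : is_distributive_lattice jn mt. Proof. by case: ba. Qed.
Let lat : is_lattice jn mt. Proof. by case: dlat. Qed.
Let jnC : commutative jn. Proof. by case: lat. Qed.
Let jnA : associative jn. Proof. by case: lat. Qed.
Let mtC : commutative mt. Proof. by case: lat. Qed.
Let mtA : associative mt. Proof. by case: lat. Qed.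
Let jnK x y : jn x (mt x y) = x. Proof. by case: lat => _ _ _ _ []. Qed.
Let mtK x y : mt x (jn x y) = x. Proof. by case: lat => _ _ _ _ []. Qed.
Let mtDl : left_distributive mt jn. Proof. by case: dlat. Qed.
Let bot_jn : left_id bot jn. Proof. by case: ba => _ []. Qed.
Let top_mt : left_id top mt. Proof. by case: ba => _ []. Qed.
Let jn_cp x : jn x (cp x) = top. Proof. by case: ba => _ []. Qed.
Let mt_cp x : mt x (cp x) = bot. Proof. by case: ba => _ []. Qed.

Let mtDr x y z : mt x (jn y z) = jn (mt x y) (mt x z).
Proof. by rewrite mtC mtDl !(mtC x). Qed.
Let jnDl x y z : jn (mt x y) z = mt (jn x z) (jn y z).
Proof.
rewrite mtDr (mtC (jn x z) z) (jnC x z) mtK mtDl.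
by rewrite (jnC (mt z y)) -jnA (jnC (mt z y) z) jnK.
Qed.
Let mt_bot x : mt x bot = bot. Proof. by rewrite -[RHS](jnK bot x) bot_jn mtC. Qed.
Let jn_top x : jn x top = top. Proof. by rewrite -[RHS](mtK top x) top_mt jnC. Qed.

Lemma complement_unique x y : mt x y = bot -> jn x y = top -> y = cp x.
Proof.
move=> xy0 xy1; rewrite -[LHS]top_mt -(jn_cp x) mtDl xy0 bot_jn.
by rewrite -[RHS]top_mt -xy1 mtDl mt_cp bot_jn mtC.
Qed.

Lemma complK : involutive cp.
Proof. by move=> x; symmetry; apply: complement_unique; rewrite 1?mtC 1?jnC. Qed.

Lemma compl_join x y : cp (jn x y) = mt (cp x) (cp y).
Proof.
symmetry; apply: complement_unique.
  rewrite mtDl mtA mt_cp (mtC bot) mt_bot bot_jn.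
  by rewrite (mtC (cp x)) mtA mt_cp (mtC bot) mt_bot.
have t1 : jn (cp x) (jn x y) = top by rewrite jnA (jnC (cp x)) jn_cp jnC jn_top.
have t2 : jn (cp y) (jn x y) = top.
  by rewrite (jnC x) jnA (jnC (cp y)) jn_cp jnC jn_top.
by rewrite jnC jnDl t1 t2 top_mt.
Qed.

Lemma compl_meet x y : cp (mt x y) = jn (cp x) (cp y).
Proof. by apply: (can_inj complK); rewrite compl_join !complK. Qed.

Lemma compl_bot : cp bot = top.
Proof. by symmetry; apply: complement_unique; rewrite ?mt_bot ?bot_jn // mtC mt_bot. Qed.

Lemma compl_top : cp top = bot.
Proof. by rewrite -compl_bot complK. Qed.

End BooleanAlgebra.

Definition boolean_axioms : seq (usentence boolean_sig) :=
  let cp n t := @App boolean_sig n ba_compl (fun=> t) in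
  let b n := @App boolean_sig n ba_bot (@args0 _) in
  let t n := @App boolean_sig n ba_top (@args0 _) in
  distributive_lattice_axioms ba_join ba_meet ++
  [:: Forall (QEq (term2 ba_join (b 1) (t1 _)) (t1 _));
      Forall (QEq (term2 ba_meet (t 1) (t1 _)) (t1 _));
      Forall (QEq (term2 ba_join (t1 _) (cp _ (t1 _))) (t 1));
      Forall (QEq (term2 ba_meet (t1 _) (cp _ (t1 _))) (b 1))].

Lemma args0_eta A (a : 'I_0 -> A) : a = @args0 A.
Proof. by apply: funext => -[]. Qed.

Lemma boolean_axiomsP A (M : structure boolean_sig A) :
  satisfies M boolean_axioms <-> boolean_algebras M.
Proof.
rewrite /boolean_axioms satisfies_cat distributive_lattice_axiomsP.
rewrite 3!satisfies_cons satisfies1 /boolean_algebras /is_boolean_algebra.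
set bot := fint M ba_bot _; set top := fint M ba_top _.
pose cp x := fint M ba_compl (fun=> x).
set J := fint2 M ba_join; set K := fint2 M ba_meet.
have bE n v (a := @args0 (term boolean_sig n)) : teval M v (App (f := ba_bot) a) = bot.
  by rewrite /= [fun i => _]args0_eta.
have tE n v (a := @args0 (term boolean_sig n)) : teval M v (App (f := ba_top) a) = top.
  by rewrite /= [fun i => _]args0_eta.
have -> : holds M
    (Forall (QEq (term2 ba_join (App (f := ba_bot) (@args0 _)) (t1 _)) (t1 _))) <->
    left_id bot J by apply: equation1P => x; rewrite ?teval_term2 ?bE.
have -> : holds M
    (Forall (QEq (term2 ba_meet (App (f := ba_top) (@args0 _)) (t1 _)) (t1 _))) <->
    left_id top K by apply: equation1P => x; rewrite ?teval_term2 ?tE.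
have -> : holds M
    (Forall (QEq (term2 ba_join (t1 _) (App (f := ba_compl) (fun=> t1 _)))
                 (App (f := ba_top) (@args0 _)))) <-> right_inverse top cp J.
  by apply: equation1P => x; rewrite ?teval_term2 ?tE.
have -> : holds M
    (Forall (QEq (term2 ba_meet (t1 _) (App (f := ba_compl) (fun=> t1 _)))
                 (App (f := ba_bot) (@args0 _)))) <-> right_inverse bot cp K.
  by apply: equation1P => x; rewrite ?teval_term2 ?bE.
by split=> [[? [? [? [? ?]]]]|[? [? ? ? ?]]].
Qed.

Lemma boolean_sym_cases (f : fun_sym boolean_sig) :
  [\/ f = ba_join, f = ba_meet, f = ba_compl | f = ba_bot \/ f = ba_top].
Proof.
case: f => -[|[|[|[|[|//]]]]] i;
  [constructor 1|constructor 2|constructor 3|constructor 4; left|constructor 4; right];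
  exact: val_inj.
Qed.

(** The generators are doubled by their complements and supplemented by the two
    constants.  Being a join of meets of these is proved for an element together
    with its complement, as complementation exchanges joins and meets. *)
Lemma boolean_generation_bound :
  generation_bound (axiomatized boolean_axioms) (fun m => 2 ^ (2 ^ (m + m + 2))).
Proof.
move=> A M _ /models_axiomatized/boolean_axiomsP baM m a gen.
pose cp x := fint M ba_compl (fun=> x).
pose G : finType := ('I_m + 'I_m + bool)%type.
pose gens (i : G) := match i with
  | inl (inl k) => a k
  | inl (inr k) => cp (a k)
  | inr b => if b then fint M ba_top (@args0 A) else fint M ba_bot (@args0 A)
  end.
have -> : m + m + 2 = #|G| by rewrite !card_sum !card_ord card_bool.
have dl := baM.1.
apply: (card_le_join_of_meets dl (gens := gens)) => x.
pose P := join_of_meets (fint2 M ba_meet) gens.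
suff both : P x /\ P (cp x) by case: both.
have [t <-] := gen x; elim: t => [i|f b IH] /=.
  by split; [apply: (@join_of_meets_gen _ _ _ dl G gens (inl (inl i)))
            |apply: (@join_of_meets_gen _ _ _ dl G gens (inl (inr i)))].
have bot_top c : P (if c then fint M ba_top (@args0 A) else fint M ba_bot (@args0 A)).
  exact: (@join_of_meets_gen _ _ _ dl G gens (inr c)).
have [fE|fE|fE|[fE|fE]] := boolean_sym_cases f; subst f.
- rewrite [fun i => _]args2_eta -/(fint2 M ba_join _ _).
  have [P0 N0] := IH ord0; have [P1 N1] := IH ord_max; split.
    exact: (join_of_meets_join dl P0 P1).
  by rewrite /cp (compl_join baM); apply: (join_of_meets_meet dl N0 N1).
- rewrite [fun i => _]args2_eta -/(fint2 M ba_meet _ _).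
  have [P0 N0] := IH ord0; have [P1 N1] := IH ord_max; split.
    exact: (join_of_meets_meet dl P0 P1).
  by rewrite /cp (compl_meet baM); apply: (join_of_meets_join dl N0 N1).
- have [P0 N0] := IH ord0.
  have -> : (fun i => teval M a (b i)) = fun=> teval M a (b ord0).
    by apply: funext => i; rewrite [i]ord1.
  by split=> //; rewrite -/(cp _) /cp (complK baM).
- rewrite [fun i => _]args0_eta; split; first exact: (bot_top false).
  by rewrite /cp (compl_bot baM); apply: (bot_top true).
- rewrite [fun i => _]args0_eta; split; first exact: (bot_top true).
  by rewrite /cp (compl_top baM); apply: (bot_top false).
Qed.

Theorem boolean_extension_decidable (I : finType) (ar : I -> nat)
    (c : forall o : I, lcondition (ar o)) : (forall o : I, lcond_wf (c o)) ->
  decidable_universal_consequences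
    (lattice_extension boolean_algebras ba_join ba_meet c).
Proof.
move=> wf_c.
apply: (@decidable_universal_consequences_ext _ _
  (lattice_extension (models (axiomatized boolean_axioms)) ba_join ba_meet c)).
  by move=> A M; rewrite /lattice_extension models_axiomatized boolean_axiomsP.
apply: lattice_extension_decidable wf_c.
- by apply: axiomatized_lattices => // A M /boolean_axiomsP[].
- exact: axiomatized_decidable.
- apply: (computable_exp2_comp (f := fun x => tadd (tadd x x) (num 2))); first by comp.
  by move=> n; rewrite !tadd_num.
- exact: boolean_generation_bound.
Qed.

Theorem corollary5p2 :
  (* Boolean algebras *)
  (forall (I : finType) (ar : I -> nat) (c : forall o : I, lcondition (ar o)),
     (forall o : I, lcond_wf (c o)) ->
     decidable_universal_consequences
       (lattice_extension boolean_algebras ba_join ba_meet c)) /\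
  (* distributive lattices *)
  (forall (I : finType) (ar : I -> nat) (c : forall o : I, lcondition (ar o)),
     (forall o : I, lcond_wf (c o)) ->
     decidable_universal_consequences
       (lattice_extension distributive_lattices lat_join lat_meet c)) /\
  (* locally finite universal theories of lattices *)
  (forall (L : signature) (jn mt : fun_sym L) (T0 : utheory L),
     theory_of_lattices T0 jn mt ->
     locally_finite T0 ->
     finite_models_decidable T0 ->
     (exists g : nat -> nat, computable g /\ generation_bound T0 g) ->
     forall (I : finType) (ar : I -> nat) (c : forall o : I, lcondition (ar o)),
     (forall o : I, lcond_wf (c o)) ->
     decidable_universal_consequences
       (lattice_extension (models T0) jn mt c)) /\
  (* partially ordered sets *)
  (forall (I : finType) (ar : I -> nat) (c : I -> condition),
     (forall o : I, cond_wf (ar o) (c o)) ->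
     decidable_universal_consequences
       (@ordered_extension _ I ar posets (le_of_rel po_le) c)) /\
  (* join semilattices *)
  (forall (I : finType) (ar : I -> nat) (c : I -> condition),
     (forall o : I, cond_wf (ar o) (c o)) ->
     decidable_universal_consequences
       (@ordered_extension _ I ar semilattices (le_of_join sl_op) c)) /\
  (* meet semilattices *)
  (forall (I : finType) (ar : I -> nat) (c : I -> condition),
     (forall o : I, cond_wf (ar o) (c o)) ->
     decidable_universal_consequences
       (@ordered_extension _ I ar semilattices (le_of_meet sl_op) c)).
Proof.
split; first exact: boolean_extension_decidable.
split; first exact: distributive_extension_decidable.
split.
  move=> L jn mt T0 T0lat _ T0dec [g [gC gB]] I ar c.
  exact: lattice_extension_decidable T0lat T0dec gC gB I ar c.
split; first exact: poset_extension_decidable.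
split; first exact: join_semilattice_extension_decidable.
exact: meet_semilattice_extension_decidable.
Qed.
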